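(* Let $d\ge 5$ be an integer and let $G$ be a $2$-connected graph with minimum degree $\delta(G)\ge d$. If $|V(G)|\ge 2d$, then $G$ has a removable $d$-matching, i.e. there is a matching $M$ of $G$ with $|M|=d$ such that $G-M$ is $2$-connected.
   Context: All graphs are finite, undirected and simple. A graph is $2$-connected if it has at least three vertices, is connected, and has no cut-vertex. For $F\subseteq E(G)$, $G-F$ denotes the graph obtained from $G$ by deleting the edges in $F$ (keeping all vertices). A matching $M$ (a set of pairwise disjoint edges) of a $2$-connected graph $G$ is removable if $G-M$ is $2$-connected. An $\ell$-matching is a matching of size $\ell$. *)

(* Defs.v *)
From mathcomp Require Import all_boot.

Set Implicit Arguments.
Unset Strict Implicit.
Unset Printing Implicit Defensive.

(* A finite simple graph on the vertex type T is a symmetric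
   irreflexive relation e : rel T; an edge is the two-element set of its ends. *)

Section Graph.

Variables (T : finType) (e : rel T).

Definition simple_graph : Prop := symmetric e /\ irreflexive e.

Definition edges : {set {set T}} :=
  [set [set p.1; p.2] | p in [set p : T * T | e p.1 p.2]].

Definition degree (x : T) : nat := #|[set y | e x y]|.

(* Every degree is smaller than #|T|, so on a nonempty simple graph the default
   value #|T| plays no role. *)
Definition min_degree : nat := \big[minn/#|T|]_(x : T) degree x.

(* G - F, on the same vertices. *)
Definition del_edges (F : {set {set T}}) : rel T :=
  [rel x y | e x y && ([set x; y] \notin F)].

(* G - v; the relation lives on T, but only vertices other than v matter, v
   being isolated. *)
Definition del_vertex (v : T) : rel T :=
  [rel x y | [&& e x y, x != v & y != v]].

Definition connected_graph : Prop := forall x y : T, connect e x y.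

(* v separates two other vertices of the same component. *)
Definition cut_vertex (v : T) : Prop :=
  exists x y : T,
    [/\ x != v, y != v, connect e x y & ~~ connect (del_vertex v) x y].

Definition two_connected : Prop :=
  [/\ 3 <= #|T|, connected_graph & forall v : T, ~ cut_vertex v].

Definition matching (M : {set {set T}}) : Prop :=
  M \subset edges /\ trivIset M.

End Graph.

Definition removable (T : finType) (e : rel T) (M : {set {set T}}) : Prop :=
  two_connected (del_edges e M).

(* Main.v *)
Require Import Defs.
From mathcomp Require Import all_boot zify.

Set Implicit Arguments.
Unset Strict Implicit.
Unset Printing Implicit Defensive.

(* Let [M] be a removable matching of maximum size, [H] = [G - M], and suppose
   that [M] covers at most [2 d - 2] vertices; call the others free.  An edge of
   [H] is essential if deleting it destroys 2-connectedness; it then lies in a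
   separation of [H] by that edge and one vertex.  Edges between free vertices
   are essential, and counting the neighbors of two free vertices [u], [v] gives
   a triangle [u x y] with [x y] in [M] and [v y] an edge; as exchanging [x y]
   for [u x], [v y] is not possible, [u x] or [v y] is essential.  So [H] has an
   essential edge and therefore two remote ends [X], [Y], where an end is an
   inclusion-minimal set with two neighbors that is not dominating.  By
   submodularity, no essential edge touches an end.  Hence exchanges that use
   edges at the ends preserve 2-connectedness, which leaves at most one free
   vertex in [X] and [Y] together.  As [X] and [Y] have at least [d - 2] covered
   vertices each, they contain nearly all covered vertices.  On the other hand a
   subgraph with essential edges only has two vertices of degree at most one, and
   such free vertices must be neighbors of [X] or [Y].  The few configurations
   left admit an exchange along a path of length three or five. *)

Ltac card_lia :=
  repeat match goal with
         | |- context [@degree ?T ?K ?x] => generalize (@degree T K x)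
         | |- context [@card ?T ?A] => generalize (@card T A)
         end; clear; intros; lia.

(** * Separations *)

Section Biconnected.

Variable T : finType.
Implicit Types (K : rel T) (w a b u v x y z p : T) (A B S X D : {set T}).

(** Cut form of 2-connectedness, as a boolean: after removal of any vertex [w], every split of the
    remaining vertices is crossed by an edge. Connectedness is implied, since two vertices stay
    joined when a third one is removed. *)
Definition biconnected K : bool :=
  (2 < #|T|) && [forall w, forall A : {set T},
    [&& w \notin A, A != set0 & ~: (w |: A) != set0] ==>
    [exists x in A, exists y in ~: (w |: A), K x y]].

Definition separates K w A : Prop :=
  [/\ w \notin A, A != set0, ~: (w |: A) != set0
    & forall x y, x \in A -> y \notin A -> y != w -> ~~ K x y].

Lemma biconnected_gt2 K : biconnected K -> 2 < #|T|.
Proof. by case/andP. Qed.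

Lemma biconnected_edge K w A a b :
  biconnected K -> w \notin A -> a \in A -> b \notin A -> b != w ->
  exists x y, [/\ x \in A, y \notin A, y != w & K x y].
Proof.
case/andP=> _ /forallP/(_ w)/forallP/(_ A)/implyP cK wA aA bA bw.
have /cK/exists_inP[x xA /exists_inP[y]] :
  [&& w \notin A, A != set0 & ~: (w |: A) != set0].
  rewrite wA /=; apply/andP; split; apply/set0Pn; first by exists a.
  by exists b; rewrite !inE negb_or bw.
by rewrite !inE negb_or => /andP[yw yA] Kxy; exists x, y.
Qed.

Lemma biconnectedP K :
  2 < #|T| -> (forall w A, ~ separates K w A) -> biconnected K.
Proof.
move=> T2 nosep; rewrite /biconnected T2; apply/forallP=> w; apply/forallP=> A.
apply/implyP=> /and3P[wA A0 B0]; apply: contra_notT (nosep w A) => /exists_inPn nK.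
split=> // x y xA yA yw; move/exists_inPn: (nK x xA); apply.
by rewrite !inE negb_or yw.
Qed.

Lemma separatesN K w A : biconnected K -> ~ separates K w A.
Proof.
move=> cK [wA A0 B0 nK]; case/set0Pn: A0 => a aA; case/set0Pn: B0 => b.
rewrite !inE negb_or => /andP[bw bA].
have [x [y [xA yA yw Kxy]]] := biconnected_edge cK wA aA bA bw.
by move: (nK x y xA yA yw); rewrite Kxy.
Qed.

Lemma not_biconnected K :
  2 < #|T| -> ~~ biconnected K -> exists w A, separates K w A.
Proof.
rewrite /biconnected => -> /= /forallPn[w /forallPn[A]].
rewrite negb_imply => /andP[/and3P[wA A0 B0] /exists_inPn nK].
exists w, A; split=> // x y xA yA yw; move/exists_inPn: (nK x xA); apply.
by rewrite !inE negb_or yw.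
Qed.

Lemma sub_biconnected K K' : subrel K K' -> biconnected K -> biconnected K'.
Proof.
move=> sub cK; apply: biconnectedP (biconnected_gt2 cK) _ => w A [wA A0 B0 nK].
apply: (separatesN (w := w) (A := A) cK); split=> // x y xA yA yw.
by apply: contra (nK x y xA yA yw) => /sub.
Qed.

Lemma separatesC K w A :
  symmetric K -> separates K w A -> separates K w (~: (w |: A)).
Proof.
move=> symK [wA A0 B0 nK]; split=> //; first by rewrite !inE eqxx.
  case/set0Pn: A0 => a aA; apply/set0Pn; exists a.
  rewrite !inE negb_or negbK aA orbT andbT.
  by apply: contraTneq aA => ->.
move=> x y; rewrite !inE !negb_or => /andP[xw xA] yA yw.
by rewrite symK; apply: nK => //; move: yA; rewrite yw /= negbK.
Qed.

Definition del_edge K a b : rel T :=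
  [rel x y | K x y && ~~ ((x == a) && (y == b) || (x == b) && (y == a))].

Definition essential K a b := ~~ biconnected (del_edge K a b).

(** A mixed cut by the vertex [w] and the edge [a b], oriented so that [a] is the end in [A]. *)
Definition edge_sep K w A a b : Prop :=
  [/\ w \notin A, a \in A, b \notin A, b != w
    & forall x y, x \in A -> y \notin A -> y != w -> K x y -> x = a /\ y = b].

Lemma del_edge_sym K a b : symmetric K -> symmetric (del_edge K a b).
Proof.
by move=> symK x y; rewrite /del_edge /= symK; do 4!case: eqP => _.
Qed.

Lemma del_edgeC K a b : del_edge K a b =2 del_edge K b a.
Proof. by move=> x y; rewrite /del_edge /= orbC. Qed.

Lemma essentialC K a b : essential K a b = essential K b a.
Proof.
by rewrite /essential; congr (~~ _); apply/idP/idP; apply: sub_biconnected => x y;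
  rewrite del_edgeC.
Qed.

(** A separation of [K] without [a b] is crossed by an edge of [K], which can only be [a b]; passing
    to the other side corrects the orientation. *)
Lemma essential_sep K a b :
  symmetric K -> biconnected K -> essential K a b ->
  exists w A, edge_sep K w A a b.
Proof.
move=> symK cK /(not_biconnected (biconnected_gt2 cK))[w [A sepA]].
wlog [aA bA bw] : A sepA / [/\ a \in A, b \notin A & b != w].
  move=> IH; have [wA A0 B0 nK] := sepA.
  case/set0Pn: (A0) => x xA; case/set0Pn: (B0) => y.
  rewrite !inE negb_or => /andP[yw yA].
  have [x1 [y1 [x1A y1A y1w Kxy]]] := biconnected_edge cK wA xA yA yw.
  move: (nK _ _ x1A y1A y1w); rewrite /del_edge /= Kxy negbK /=.
  case/orP=> /andP[/eqP ? /eqP ?]; subst; first by apply: (IH A).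
  apply: (IH (~: (w |: A))); first exact: separatesC (del_edge_sym _ _ symK) sepA.
  rewrite !inE negbK negb_or y1w y1A x1A orbT; split=> //.
  by apply: contraTneq x1A => ->.
exists w, A; have [wA _ _ nK] := sepA; split=> // x y xA yA yw Kxy.
move: (nK x y xA yA yw); rewrite /del_edge /= Kxy negbK /= => /orP[] /andP[/eqP xE /eqP yE] //.
by move: bA; rewrite -xE xA.
Qed.

Lemma edge_sepC K w A a b :
  symmetric K -> edge_sep K w A a b -> edge_sep K w (~: (w |: A)) b a.
Proof.
move=> symK [wA aA bA bw uK]; split.
- by rewrite !inE eqxx.
- by rewrite !inE negb_or bw.
- by rewrite !inE negbK aA orbT.
- by apply: contraTneq aA => ->.
move=> x y; rewrite !inE negbK negb_or => /andP[xw xA].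
by move=> /orP[/eqP-> /eqP //|yA] yw; rewrite symK => /(uK _ _ yA xA xw)[-> ->].
Qed.

Definition neighbors K S := [set y | (y \notin S) && [exists x in S, K x y]].

Lemma neighborsP K S y :
  reflect (y \notin S /\ exists2 x, x \in S & K x y) (y \in neighbors K S).
Proof. by rewrite inE; apply: (iffP andP) => -[? /exists_inP]. Qed.

Lemma neighborsI K S x y : x \in S -> y \notin S -> K x y -> y \in neighbors K S.
Proof. by move=> xS yS Kxy; apply/neighborsP; split=> //; exists x. Qed.

(** Submodularity of the vertex boundary: after inclusion-exclusion on both sides, the unions and
    the intersections are compared separately. *)
Lemma card_neighbors_submod K S S' :
  #|neighbors K (S :&: S')| + #|neighbors K (S :|: S')|
    <= #|neighbors K S| + #|neighbors K S'|.
Proof.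
rewrite -cardsUI -[leqRHS]cardsUI; apply: leq_add; apply/subset_leq_card/subsetP=> y.
  rewrite 2!in_setU => /orP[] /neighborsP[yS [x xS Kxy]].
    move: yS xS; rewrite !in_setI negb_and => yS /andP[xS xS'].
    by case/orP: yS => yS; apply/orP; [left|right]; apply: neighborsI Kxy.
  move: yS xS; rewrite !in_setU negb_or => /andP[yS yS'].
  by case/orP=> xS; apply/orP; [left|right]; apply: neighborsI Kxy.
rewrite !inE !negb_or => /andP[/andP[_ /exists_inP[x]]].
rewrite inE => /andP[xS xS'] Kxy /andP[/andP[-> ->] _] /=.
by apply/andP; split; apply/exists_inP; exists x.
Qed.

(** A single neighbor of [S] would be a cut-vertex between [S] and [z]. *)
Lemma neighbors_gt1 K S z :
  symmetric K -> biconnected K -> S != set0 -> z \notin S -> z \notin neighbors K S ->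
  1 < #|neighbors K S|.
Proof.
move=> symK cK /set0Pn[s sS] zS zN; rewrite ltnNge; apply/negP=> N1.
have key w : w \notin S -> neighbors K S \subset [set w] -> z = w.
  move=> wS /subsetP Nw; apply/eqP; apply/negPn/negP=> zw.
  have [x [y [xS yS yw Kxy]]] := biconnected_edge cK wS sS zS zw.
  by move: (Nw y (neighborsI xS yS Kxy)); rewrite inE (negbTE yw).
have [N0|[w wN]] := set_0Vmem (neighbors K S); last first.
  have Nw : neighbors K S = [set w].
    by apply/esym/eqP; rewrite eqEcard sub1set wN cards1.
  have /neighborsP[wS _] := wN.
  by move: zN; rewrite (key w wS) ?wN // Nw.
(* Without neighbors, [S] is everything but [z]. Removing a second vertex of [S] still leaves an
   edge from [z] into [S]. *)
have Sz w : w != z -> w \in S.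
  by move=> wz; apply: contraNT wz => wS; rewrite -(key w) // N0 sub0set.
have [w] : exists w, w \in S :\ s.
  apply/card_gt0P; move: (cardsD1 s S) (biconnected_gt2 cK) (cardsC S).
  have /subset_leq_card : ~: S \subset [set z].
    by apply/subsetP=> w; rewrite !inE; apply: contraNT => /Sz.
  rewrite cards1 sS; lia.
rewrite !inE => /andP[ws wS].
have wz : w \notin [set z] by rewrite inE; apply: contraNneq zS => <-.
have [||x [y [/set1P-> yz _ Kzy]]] :=
    biconnected_edge (a := z) (b := s) cK wz (set11 z).
- by rewrite inE; apply: contraNneq zS => <-.
- by rewrite eq_sym.
move: yz; rewrite inE => /Sz yS.
by move: zN => /negP; apply; apply: neighborsI yS zS _; rewrite symK.
Qed.

(** A fragment in the sense of connectivity theory, for cuts of two vertices; the last clause asks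
    for a vertex beyond the cut. *)
Definition fragment K X :=
  [&& X != set0, #|neighbors K X| == 2 & ~: (X :|: neighbors K X) != set0].

Definition end_fragment K X := minset (fragment K) X.

Lemma fragmentI K X x z :
  symmetric K -> biconnected K -> x \in X -> z \notin X -> z \notin neighbors K X ->
  #|neighbors K X| <= 2 -> fragment K X.
Proof.
move=> symK cK xX zX zN N2; have X0 : X != set0 by apply/set0Pn; exists x.
rewrite /fragment X0 eqn_leq N2 (neighbors_gt1 symK cK X0 zX zN) /=.
by apply/set0Pn; exists z; rewrite in_setC in_setU negb_or zX.
Qed.

Lemma end_fragment_exists K X :
  fragment K X -> exists2 Y, end_fragment K Y & Y \subset X.
Proof. by case/minset_exists=> Y; exists Y. Qed.

Lemma end_fragment_min K X Y :
  end_fragment K X -> fragment K Y -> Y \subset X -> Y = X.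
Proof. by case/minsetP=> _; apply. Qed.

Lemma degreeE K x : degree K x = #|[set y | K x y]|.
Proof. by []. Qed.

Lemma degree_sub K x S : (forall y, K x y -> y \in S) -> degree K x <= #|S|.
Proof. by move=> KS; apply/subset_leq_card/subsetP=> y; rewrite inE => /KS. Qed.

Lemma edge_sep_neighbors K w A a b :
  edge_sep K w A a b -> neighbors K A \subset [set w; b].
Proof.
case=> wA aA bA bw uK; apply/subsetP=> y /neighborsP[yA [x xA Kxy]].
rewrite !inE; have [//|yw] := eqVneq y w.
by have [_ ->] := uK x y xA yA yw Kxy; rewrite eqxx.
Qed.

Lemma card_subset2 (S : {set T}) a b : S \subset [set a; b] -> #|S| <= 2.
Proof. by move/subset_leq_card/leq_trans; apply; rewrite cards2; case: eqP. Qed.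

End Biconnected.

(** * Essential edges and ends *)

Section Ends.

Variables (T : finType) (K : rel T).
Hypotheses (symK : symmetric K) (irrK : irreflexive K).
Hypotheses (cK : biconnected K) (deg3 : forall x, 2 < degree K x).
Implicit Types (w a b u v x y z p : T) (A B S X D : {set T}).

(** If [x1] were the only neighbor of [p] in [X], then [X :\ x1] would be a smaller fragment, with
    [x1] replacing [p] in the cut. It is nonempty because [x1] has degree at least three. *)
Lemma end_fragment_neighbor2 X p :
  end_fragment K X -> p \in neighbors K X ->
  exists x1 x2, [/\ x1 \in X, x2 \in X, x1 != x2, K p x1 & K p x2].
Proof.
move=> endX pN; have /minsetp/and3P[X0 /eqP N2 C0] := endX.
have /neighborsP[pX [x1 x1X]] := pN; rewrite symK => Kp1.
have [/exists_inP[x2 x2X /andP[x21 Kp2]]|noX] :=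
  boolP [exists x2 in X, (x1 != x2) && K p x2]; first by exists x1, x2.
have onlyx1 x : x \in X -> K p x -> x = x1.
  move=> xX Kpx; apply/esym/eqP/negPn/negP=> ne.
  by move/exists_inP: noX; apply; exists x; rewrite ?ne.
have NX1 : neighbors K (X :\ x1) \subset x1 |: (neighbors K X :\ p).
  apply/subsetP=> y /neighborsP[yX1 [x]]; rewrite !inE => /andP[xx1 xX] Kxy.
  have [//|yx1] := eqVneq y x1; have yX : y \notin X by move: yX1; rewrite !inE yx1.
  rewrite yX /=; apply/andP; split; last by apply/exists_inP; exists x.
  by apply: contraNneq xx1 => yp; apply/eqP/onlyx1; rewrite // symK -yp.
have [x] : exists x, x \in X :\ x1.
  apply/card_gt0P; have := deg3 x1.
  have /degree_sub : forall y, K x1 y -> y \in (X :\ x1) :|: neighbors K X.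
    move=> y Ky; rewrite in_setU in_setD1.
    have [yX|yX] := boolP (y \in X); last by rewrite (neighborsI x1X yX Ky) orbT.
    by rewrite andbT; case: eqP Ky => // ->; rewrite irrK.
  by move=> /leq_trans/(_ (leq_card_setU _ _)); rewrite N2; card_lia.
move=> xX1; suff /(end_fragment_min endX) eqX : fragment K (X :\ x1).
  by have := x1X; rewrite -eqX ?subsetDl // !inE eqxx.
apply: (fragmentI symK cK xX1 (z := p)).
- by rewrite !inE negb_and pX orbT.
- apply/neighborsP=> -[_ [y]]; rewrite !inE => /andP[yx1 yX] Kyp.
  by move: yx1; rewrite (onlyx1 y) ?eqxx // symK.
apply: leq_trans (subset_leq_card NX1) _.
rewrite cardsU1; move: (cardsD1 p (neighbors K X)); rewrite pN N2.
by case: (_ \notin _); card_lia.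
Qed.

(* If [X] meets both sides of a separation by one vertex and one edge with an
   end in [X], submodularity of the number of neighbors and the minimality of
   [X] leave no room for the complement of [X] and its neighbors. *)
Lemma end_fragment_corner X w S a b x x0 y :
  end_fragment K X -> edge_sep K w S a b -> x \in X -> x \in S ->
  x0 \in X -> x0 \notin S -> y \in ~: (X :|: neighbors K X) ->
  y \notin S -> y != w -> y != b -> False.
Proof.
move=> endX /edge_sep_neighbors NS xX xS x0X x0S yXN yS yw yb.
have /minsetp/and3P[X0 /eqP N2 C0] := endX.
move: yXN; rewrite in_setC in_setU negb_or => /andP[yX yN].
have NS2 := card_subset2 NS.
have yNS : y \notin neighbors K S.
  by apply/negP=> /(subsetP NS); rewrite !inE (negbTE yw) (negbTE yb).
have yXS : y \notin neighbors K (X :|: S).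
  apply/neighborsP=> -[_ [z]]; rewrite in_setU => /orP[] zS Kzy.
    by move: yN; rewrite (neighborsI zS yX Kzy).
  by move: yNS; rewrite (neighborsI zS yS Kzy).
have NXS : 1 < #|neighbors K (X :|: S)|.
  apply: (neighbors_gt1 symK cK _ _ yXS); last by rewrite in_setU negb_or yX.
  by apply/set0Pn; exists x; rewrite in_setU xX.
have subm := card_neighbors_submod K X S.
suff /(end_fragment_min endX) XS : fragment K (X :&: S).
  by move: x0X; rewrite -XS ?subsetIl // in_setI (negbTE x0S) andbF.
apply: (fragmentI symK cK (x := x) (z := y)); rewrite ?in_setI ?xX ?(negbTE yX) //.
  apply/neighborsP=> -[_ [z]]; rewrite in_setI => /andP[zX _] Kzy.
  by move: yN; rewrite (neighborsI zX yX Kzy).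
move: subm NXS NS2; rewrite N2; card_lia.
Qed.

(** A mixed cut through [v p] is crossed with the cut around [X]; submodularity and degrees exclude
    every position of the corners. *)
Lemma end_fragment_not_essential X v p :
  end_fragment K X -> v \in X -> K v p -> ~~ essential K v p.
Proof.
move=> endX vX Kvp; apply/negP=> /(essential_sep symK cK)[w [A sepA]].
have sepB := edge_sepC symK sepA; set B := ~: (w |: A) in sepB.
have /minsetp/and3P[X0 /eqP N2 C0] := endX.
set Y := ~: (X :|: neighbors K X) in C0.
have [wA vA pA pw uK] := sepA; have [_ pB vB vw _] := sepB.
have YN y x : y \in Y -> x \in X -> ~~ K x y.
  rewrite in_setC in_setU negb_or => /andP[yX yN] xX.
  by apply: contra yN; exact: neighborsI.
have pXN : p \in X \/ p \in neighbors K X.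
  by have [|pX] := boolP (p \in X); [left|right; apply: neighborsI Kvp].
have pY : p \notin Y by rewrite in_setC in_setU negbK; apply/orP.
(* If [X] lies in [A], then [p] is a neighbor of [X] with two neighbors in [X], and both of these
   edges would cross the mixed cut. *)
have [XA|/subsetPn[x0 x0X x0A]] := boolP (X \subset A).
  case: pXN => [/(subsetP XA)|pN]; first by rewrite (negbTE pA).
  have [x1 [x2 [x1X x2X /eqP x12 Kp1 Kp2]]] := end_fragment_neighbor2 endX pN.
  apply: x12; rewrite symK in Kp1; rewrite symK in Kp2.
  have [-> _] := uK _ _ (subsetP XA _ x1X) pA pw Kp1.
  by have [-> _] := uK _ _ (subsetP XA _ x2X) pA pw Kp2.
have YA y : y \in Y -> (y \in A) || (y == w).
  move=> yY; apply/negPn/negP; rewrite negb_or => /andP[yA yw].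
  apply: (end_fragment_corner endX sepA vX vA x0X x0A yY yA yw).
  by apply: contraNneq pY => <-.
(* If [X] meets [B], the corner argument works from both sides, so only [w] lies beyond the end; its
   neighbors are among the two neighbors of [X], against its degree. *)
have [/subsetPn[x1 x1X]|XB] := boolP (~~ (X \subset ~: B)).
  rewrite in_setC negbK => x1B.
  have Yw y : y \in Y -> y = w.
    move=> yY; apply/eqP/negPn/negP=> yw; have := YA y yY; rewrite (negbTE yw) orbF => yA.
    have yB : y \notin B by rewrite !inE yA orbT.
    apply: (end_fragment_corner endX sepB x1X x1B vX vB yY yB yw).
    by apply: contraTneq yY => ->; rewrite in_setC in_setU vX.
  have [y yY] := set0Pn _ C0; have wY := yY; rewrite (Yw y yY) in wY.
  have := deg3 w; rewrite ltnNge -N2 => /negP; apply; apply: degree_sub => z Kwz.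
  have zX : z \notin X.
    by apply/negP=> zX; move: (YN _ _ wY zX); rewrite symK Kwz.
  apply/negPn/negP=> zN; move: Kwz; rewrite (Yw z) ?irrK //.
  by rewrite in_setC in_setU negb_or zX.
(* Otherwise [B] consists of at most two neighbors of [X], and one of them has degree at most
   two. *)
rewrite negbK in XB; have BN : B \subset neighbors K X.
  apply/subsetP=> b bB; have bX : b \notin X.
    by apply: contraL bB => /(subsetP XB); rewrite in_setC.
  apply/negPn/negP=> bN; have bY : b \in Y by rewrite in_setC in_setU negb_or bX.
  by move: (YA b bY) bB; rewrite !inE orbC => ->.
have B2 : #|B| <= 2 by rewrite -N2 subset_leq_card.
have [B1|[q]] := set_0Vmem (B :\ p).
  have := deg3 p; rewrite ltnNge => /negP; apply.
  apply: leq_trans (_ : #|[set w; v]| <= 2); last by rewrite cards2; case: eqP.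
  apply: degree_sub => y Kpy; rewrite !inE; have [//|yw] := eqVneq y w.
  have [yB|yB] := boolP (y \in B).
    have : y \in B :\ p.
      by rewrite in_setD1 yB andbT; apply: contraTneq Kpy => ->; rewrite irrK.
    by rewrite B1 inE.
  by have [_ _ _ _ uB] := sepB; have [_ ->] := uB _ _ pB yB yw Kpy; rewrite eqxx.
rewrite in_setD1 => /andP[qp qB]; have := deg3 q; rewrite ltnNge => /negP; apply.
apply: leq_trans (_ : #|w |: (B :\ q)| <= 2).
  apply: degree_sub => y Kqy; rewrite in_setU1; have [//|yw /=] := eqVneq y w.
  rewrite in_setD1; apply/andP; split; first by apply: contraTneq Kqy => ->; rewrite irrK.
  apply/negPn/negP=> yB; have [_ _ _ _ uB] := sepB.
  by have [qp' _] := uB _ _ qB yB yw Kqy; rewrite qp' eqxx in qp.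
by rewrite cardsU1; move: (cardsD1 q B) B2; rewrite qB; case: (w \notin _); card_lia.
Qed.

(** In the descent along essential edges, this keeps the next edge from leading to the cut vertex
    [w]. The two cuts are uncrossed. *)
Lemma edge_sep_other w A u v w' A' :
  K u v -> K u w -> edge_sep K w A u v -> edge_sep K w' A' u w -> False.
Proof.
move=> Kuv Kuw [wA uA vA vw uK] [wA' uA' wA'2 ww' uK'].
have uw : u != w by apply: contraNneq wA => <-.
(* Without such a [g], the vertex [u] would cut the rest of [A] off from [w]. *)
have [g [gA gu Kgw]] : exists g, [/\ g \in A, g != u & K g w].
  have [f fA fu] : exists2 f, f \in A & f != u.
    apply/exists_inP; apply: contraTT (deg3 u) => /exists_inPn noA.
    rewrite -leqNgt; apply: leq_trans (_ : #|[set w; v]| <= 2).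
      apply: degree_sub => y Kuy; rewrite !inE; have [//|yw] := eqVneq y w.
      have [yA|yA] := boolP (y \in A).
        by move: (noA _ yA) Kuy; rewrite negbK => /eqP->; rewrite irrK.
      by have [_ ->] := uK _ _ uA yA yw Kuy; rewrite eqxx.
    by rewrite cards2; case: eqP.
  have [||||x [y []]] := biconnected_edge (w := u) (A := A :\ u) (a := f) (b := w) cK.
  - by rewrite !inE eqxx.
  - by rewrite !inE fu.
  - by rewrite !inE negb_and wA orbT.
  - by rewrite eq_sym.
  rewrite !inE negb_and negbK => /andP[xu xA] /orP[/eqP->|yA] yu Kxy.
    by rewrite eqxx in yu.
  have [yw|yw] := eqVneq y w; first by exists x; rewrite -yw.
  by have [xu' _] := uK _ _ xA yA yw Kxy; rewrite xu' eqxx in xu.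
have gA' : g \notin A'.
  by apply/negP=> gA'; have [gu' _] := uK' _ _ gA' wA'2 ww' Kgw; rewrite gu' eqxx in gu.
have vA' : v \in A' \/ v = w'.
  have [|vA'] := boolP (v \in A'); [by left|right; apply/eqP/negPn/negP=> vw'].
  by have [_ vw2] := uK' _ _ uA' vA' vw' Kuv; rewrite vw2 eqxx in vw.
(* If [w'] is in [A], the corner [A' :\: A], which contains [v], can be left only through [u];
   otherwise [A :\: A'], which contains [g], can be left only through [w]. *)
have [wA3|wA3] := boolP (w' \in A).
  have {}vA' : v \in A' by case: vA' => // vw'; rewrite vw' wA3 in vA.
  have [||||x [y []]] := biconnected_edge (w := u) (A := A' :\: A) (a := v) (b := w) cK.
  - by rewrite !inE uA.
  - by rewrite !inE vA.
  - by rewrite !inE negb_and wA'2 orbT.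
  - by rewrite eq_sym.
  rewrite !inE negb_and negbK => /andP[xA xA'] yAA' yu Kxy.
  have [yA|yA] := boolP (y \in A).
    have xw : x != w by apply: contraNneq wA'2 => <-.
    by rewrite symK in Kxy; have [yu' _] := uK _ _ yA xA xw Kxy; rewrite yu' eqxx in yu.
  rewrite (negbTE yA) /= in yAA'.
  have yw' : y != w' by apply: contraNneq yA => ->.
  by have [xu _] := uK' _ _ xA' yAA' yw' Kxy; rewrite xu uA in xA.
have gw' : g != w' by apply: contraNneq wA3 => <-.
have [||||x [y []]] := biconnected_edge (w := w) (A := A :\: A') (a := g) (b := u) cK.
- by rewrite !inE negb_and wA orbT.
- by rewrite !inE gA'.
- by rewrite !inE uA'.
- by [].
rewrite !inE negb_and negbK => /andP[xA' xA] yAA' yw Kxy.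
have [yA|yA] := boolP (y \in A).
  rewrite yA orbF in yAA'; rewrite symK in Kxy.
  have xw' : x != w' by apply: contraNneq wA3 => <-.
  by have [_ xw] := uK' _ _ yAA' xA' xw' Kxy; rewrite -xw xA in wA.
by have [xu _] := uK _ _ xA yA yw Kxy; rewrite xu uA' in xA'.
Qed.

(** The descent step: the smaller side is either the corner [A :&: B'] or [A'] itself. *)
Lemma edge_sep_nested w A u v w' A' z :
  K u v -> K u z -> z \in A -> edge_sep K w A u v -> edge_sep K w' A' u z ->
  exists w1 A1, A1 \proper A /\ (edge_sep K w1 A1 u z \/ edge_sep K w1 A1 z u).
Proof.
move=> Kuv Kuz zA sepA sepA'.
have [wA uA vA vw uK] := sepA; have [wA' uA' zA' zw' uK'] := sepA'.
set B' := ~: (w' |: A').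
have zu : z != u by apply: contraTneq Kuz => ->; rewrite irrK.
have zB' : z \in B' by rewrite !inE negb_or zw'.
have sepB' : edge_sep K w' B' z u := edge_sepC symK sepA'.
(* As [u] is not a cut-vertex, the corner has a neighbor [y] other than [u]; the two cuts leave only
   [w] and [w'] as candidates. *)
have [x [y [xA xB' yAB yu Kxy]]] :
    exists x y, [/\ x \in A, x \in B', y \notin A :&: B', y != u & K x y].
  have [||||x [y [xAB yAB yu Kxy]]] :=
    biconnected_edge (w := u) (A := A :&: B') (a := z) (b := v) cK.
  - by rewrite !inE uA' orbT andbF.
  - by rewrite inE zA.
  - by rewrite inE negb_and vA.
  - by apply: contraTneq Kuv => ->; rewrite irrK.
  by move: xAB; rewrite inE => /andP[xA xB']; exists x, y.
have xA' : x \notin A' by move: xB'; rewrite !inE negb_or => /andP[].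
have xw' : x != w' by move: xB'; rewrite !inE negb_or => /andP[].
have xu : x != u by apply: contraNneq xA' => ->.
have yA' : y \notin A'.
  apply/negP=> yA'; rewrite symK in Kxy.
  by have [yu' _] := uK' _ _ yA' xA' xw' Kxy; rewrite yu' eqxx in yu.
have yw : y \notin A -> y = w.
  move=> yA; apply/eqP/negPn/negP=> yw.
  by have [xu' _] := uK _ _ xA yA yw Kxy; rewrite xu' eqxx in xu.
have yw' : y \in A -> y = w'.
  by move=> yA; apply/eqP/negPn/negP=> yw'; move: yAB; rewrite !inE yA negb_or yA' yw'.
(* With a vertex [q] in the opposite corner, submodularity leaves [A :&: B'] only the neighbors [u]
   and [y], so [y] is the vertex of the new cut. *)
have [[q [qw qA qv qA']]|Q0] :
    (exists q, [/\ q != w, q \notin A, q != v & q \in A'])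
    \/ {in A', forall q, [|| q \in A, q == w | q == v]}.
  have [/exists_inP[q qA' /and3P[]]|/exists_inPn Q0] :=
    boolP [exists q in A', [&& q != w, q \notin A & q != v]]; first by left; exists q.
  by right=> q /Q0; rewrite !negb_and !negbK orbCA.
- have NA := edge_sep_neighbors sepA; have NB' := edge_sep_neighbors sepB'.
  have qB' : q \notin B' by rewrite !inE qA' orbT.
  have q_far : q \notin neighbors K (A :|: B').
    apply/neighborsP=> -[_ [t]]; rewrite in_setU => /orP[] tS Ktq.
      by have := subsetP NA q (neighborsI tS qA Ktq); rewrite !inE (negbTE qw) (negbTE qv).
    have := subsetP NB' q (neighborsI tS qB' Ktq); rewrite !inE => /orP[] /eqP qE.
      by rewrite -qE qA' in wA'.
    by rewrite qE uA in qA.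
  have gt1 : 1 < #|neighbors K (A :|: B')|.
    apply: (neighbors_gt1 symK cK _ _ q_far); last by rewrite in_setU negb_or qA.
    by apply/set0Pn; exists u; rewrite in_setU uA.
  have uAB : u \notin A :&: B' by rewrite in_setI uA !inE uA' orbT.
  have NAB : neighbors K (A :&: B') = [set u; y].
    apply/esym/eqP; rewrite eqEcard cards2 eq_sym yu; apply/andP; split.
      apply/subsetP=> t; rewrite !in_set2 => /orP[] /eqP->.
        by apply: (neighborsI (x := z)); rewrite // ?in_setI ?zA // symK.
      by apply: (neighborsI (x := x)); rewrite // in_setI xA.
    move: (card_neighbors_submod K A B') gt1 (card_subset2 NA) (card_subset2 NB').
    by card_lia.
  exists y, (A :&: B'); split.
    by apply/properP; split; [exact: subsetIl | exists u].
  right; split=> //; [by rewrite in_setI zA | by rewrite eq_sym |].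
  move=> a c aAB cAB cy Kac; have := neighborsI aAB cAB Kac.
  rewrite NAB !inE (negbTE cy) orbF => /eqP cu; split=> //.
  have uw' : u != w' by apply: contraNneq wA' => <-.
  have [_ _ uB' _ uKB] := sepB'; rewrite cu in Kac.
  by move: aAB; rewrite in_setI => /andP[_ aB']; have [] := uKB _ _ aB' uB' uw' Kac.
(* Now [A'] lies in [A] together with [w] and [v]. If [v] is in [A'], its degree forces [w] into
   [A'] and [w'] out of [A], so neither candidate for [y] remains. *)
have [vA'|vA'] := boolP (v \in A').
  suff [wA'2 wA3] : w \in A' /\ w' \notin A.
    have [yA|/yw yE] := boolP (y \in A); first by rewrite -(yw' yA) yA in wA3.
    by rewrite yE wA'2 in yA'.
  have Nv t : K v t -> (t == u) || (t == w') && (t \notin A) || (t == w) && (t \in A').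
    move=> Kvt; have vu : v != u by apply: contraNneq vA => ->.
    have [tA|tA] := boolP (t \in A).
      by rewrite symK in Kvt; have [-> _] := uK _ _ tA vA vw Kvt; rewrite eqxx.
    have [tA'|tA'] := boolP (t \in A'); last first.
      have [->|tw'] := eqVneq t w'; first by rewrite orbT.
      by have [vu' _] := uK' _ _ vA' tA' tw' Kvt; rewrite vu' eqxx in vu.
    have /or3P[tA2|->|/eqP tv] := Q0 t tA'; last by rewrite tv irrK in Kvt.
      by rewrite tA2 in tA.
    by rewrite orbT.
  have degv s : (forall t, K v t -> t \in [set u; s]) -> False.
    by move/degree_sub; rewrite cards2; move: (deg3 v); case: (_ != _); card_lia.
  split.
    apply/negPn/negP=> wA'2; apply: (degv w') => t /Nv; rewrite !inE.
    by case/orP=> [/orP[->|/andP[-> _]]|/andP[/eqP->]]; rewrite ?orbT // (negbTE wA'2).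
  apply/negP=> wA3; apply: (degv w) => t /Nv; rewrite !inE.
  by case/orP=> [/orP[->|/andP[/eqP->]]|/andP[->]]; rewrite ?orbT // wA3.
(* The edge [u v] may leave [A'] only to [w']. If [w] is in [A'], again no [y] remains; if not, [A']
   is a proper subset of [A]. *)
have uvw' : v = w'.
  apply/eqP/negPn/negP=> vw'; have [_ vz] := uK' _ _ uA' vA' vw' Kuv.
  by rewrite -vz (negbTE vA) in zA.
have [wA'2|wA'2] := boolP (w \in A').
  have [/[dup] yA /yw' yE|/yw yE] := boolP (y \in A).
    by rewrite -uvw' in yE; rewrite -yE yA in vA.
  by rewrite yE wA'2 in yA'.
exists w', A'; split; last by left.
apply/properP; split; last by exists z.
apply/subsetP=> t /[dup] tA' /Q0 /or3P[//|/eqP tE|/eqP tE].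
  by rewrite tE (negbTE wA'2) in tA'.
by rewrite tE (negbTE vA') in tA'.
Qed.

(** Induction on the size of [A]: a second neighbor [z] of [u] in [D] lies in [A] and yields a
    smaller mixed cut; without one, [u] is the leaf. *)
Lemma edge_sep_leaf D w A u v :
  {in D &, forall a b, K a b -> essential K a b} ->
  u \in D -> v \in D -> K u v -> edge_sep K w A u v ->
  exists l, [/\ l \in A, l \in D & {in D &, forall z z', K l z -> K l z' -> z = z'}].
Proof.
move=> essD; have [n] := ubnP #|A|; elim: n => // n IH in w A u v *.
rewrite ltnS => An uD vD Kuv sepA; have [wA uA vA vw uK] := sepA.
have [/exists_inP[z zD /andP[zv Kuz]]|noz] :=
  boolP [exists z in D, (z != v) && K u z]; last first.
  have onlyv z : z \in D -> K u z -> z = v.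
    move=> zD Kuz; apply/eqP; apply: contraNT noz => zv.
    by apply/exists_inP; exists z; rewrite ?zv.
  by exists u; split=> // z z' zD z'D /(onlyv _ zD)-> /(onlyv _ z'D)->.
have [w' [A' sepA']] := essential_sep symK cK (essD u z uD zD Kuz).
have [zA|zA] := boolP (z \in A); last first.
  have [zw|zw] := eqVneq z w; last first.
    by have [_ zv'] := uK _ _ uA zA zw Kuz; rewrite zv' eqxx in zv.
  by subst z; case: (edge_sep_other Kuv Kuz sepA sepA').
have [w1 [A1 [ltA1 sepA1]]] := edge_sep_nested Kuv Kuz zA sepA sepA'.
have ltn1 : #|A1| < n by exact: leq_trans (proper_card ltA1) An.
suff [l [lA1 lD lP]] : exists l, [/\ l \in A1, l \in D
    & {in D &, forall z z', K l z -> K l z' -> z = z'}].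
  by exists l; split=> //; apply: (subsetP (proper_sub ltA1)).
case: sepA1 => sepA1; first exact: (IH w1 A1 u z ltn1 uD zD Kuz sepA1).
by apply: (IH w1 A1 z u ltn1 zD uD _ sepA1); rewrite symK.
Qed.

(** Each side of the mixed cut of one edge in [D] contains a leaf; if [D] spans no edge, any two of
    its vertices serve. *)
Lemma essential_leaves D :
  {in D &, forall a b, K a b -> essential K a b} -> 1 < #|D| ->
  exists l1 l2, [/\ l1 \in D, l2 \in D, l1 != l2,
    #|[set z in D | K l1 z]| <= 1 & #|[set z in D | K l2 z]| <= 1].
Proof.
move=> essD D1.
have leaf1 l : {in D &, forall z z', K l z -> K l z' -> z = z'} ->
    #|[set z in D | K l z]| <= 1.
  move=> lP; apply/card_le1_eqP => z z'; rewrite !inE => /andP[zD Kz] /andP[z'D Kz'].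
  exact: lP.
have [/exists_inP[u uD /exists_inP[v vD Kuv]]|noedge] :=
  boolP [exists u in D, exists v in D, K u v].
  have [w [A sepA]] := essential_sep symK cK (essD u v uD vD Kuv).
  have [l1 [l1A l1D /leaf1 l1P]] := edge_sep_leaf essD uD vD Kuv sepA.
  have sepB := edge_sepC symK sepA; have Kvu : K v u by rewrite symK.
  have [l2 [l2B l2D /leaf1 l2P]] := edge_sep_leaf essD vD uD Kvu sepB.
  exists l1, l2; split=> //; apply: contraTneq l2B => <-.
  by rewrite !inE l1A orbT.
have [l1 [l2 [l1D l2D l12]]] := card_gt1P D1.
have no l : l \in D -> {in D &, forall z z', K l z -> K l z' -> z = z'}.
  move=> lD z z' zD _ Klz; case/exists_inP: noedge; exists l => //.
  by apply/exists_inP; exists z.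
by exists l1, l2; split=> //; apply/leaf1/no.
Qed.

(** Both sides of the mixed cut contain fragments, hence ends. *)
Lemma essential_ends a b : K a b -> essential K a b ->
  exists X Y, [/\ end_fragment K X, end_fragment K Y
    & forall x y, x \in X -> y \in Y -> x != y /\ ~~ K x y].
Proof.
move=> Kab /(essential_sep symK cK)[w [A sepA]].
have sepB := edge_sepC symK sepA; have [wA aA bA bw uK] := sepA.
have aw : a != w by apply: contraNneq wA => <-.
have ba : b != a by apply: contraNneq bA => ->.
have [y Kby] : exists2 y, K b y & y \notin [set w; a].
  apply/exists_inP; apply: contraTT (deg3 b) => /exists_inPn sub.
  rewrite -leqNgt; apply: leq_trans (_ : #|[set w; a]| <= 2).
    by apply: degree_sub => y Kby; have := sub y Kby; rewrite negbK.
  by rewrite cards2; case: eqP.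
rewrite !inE negb_or => /andP[yw ya].
have yA : y \notin A.
  apply/negP=> yA; rewrite symK in Kby.
  by have [ya' _] := uK _ _ yA bA bw Kby; rewrite ya' eqxx in ya.
have yb : y != b by apply: contraTneq Kby => ->; rewrite irrK.
have NA := edge_sep_neighbors sepA.
have fA : fragment K A.
  apply: (fragmentI symK cK aA yA) (card_subset2 NA).
  by apply/negP=> /(subsetP NA); rewrite !inE (negbTE yw) (negbTE yb).
(* Dropping [b] removes the only contact with [A]; the vertex [y] keeps the set nonempty. *)
set C := ~: (w |: A) :\ b.
have NC : neighbors K C \subset [set w; b].
  apply/subsetP=> t /neighborsP[tC [c]]; rewrite in_setD1 => /andP[cb cB] Kct.
  rewrite !inE; have [//|tw] := eqVneq t w; have [//|tb /=] := eqVneq t b.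
  have tA : t \notin ~: (w |: A) by move: tC; rewrite in_setD1 tb.
  have [_ _ _ _ uB] := sepB.
  by have [cb' _] := uB _ _ cB tA tw Kct; rewrite cb' eqxx in cb.
have fC : fragment K C.
  apply: (fragmentI symK cK (x := y) (z := a) _ _ _ (card_subset2 NC)).
  - by rewrite !inE negb_or yb yw.
  - by rewrite !inE aA !orbT andbF.
  - by apply/negP=> /(subsetP NC); rewrite !inE (negbTE aw) eq_sym (negbTE ba).
have [X endX /subsetP XA] := end_fragment_exists fA.
have [Y endY /subsetP YC] := end_fragment_exists fC.
exists X, Y; split=> // x z /XA xA /YC; rewrite !inE negb_or => /and3P[zb zw zA].
split; first by apply: contraNneq zA => <-.
by apply/negP=> Kxz; have [_ zb'] := uK _ _ xA zA zw Kxz; rewrite zb' eqxx in zb.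
Qed.

End Ends.

(** * Ends after the deletion of an edge away from them *)

Section DeleteEdge.

Variables (T : finType) (K : rel T).
Implicit Types (a b x : T) (S X : {set T}).

Lemma degree_del_edge a b x :
  degree K x <= (degree (del_edge K a b) x).+1.
Proof.
rewrite !degreeE; set b' := if x == a then b else a.
apply: leq_trans (_ : #|b' |: [set y | del_edge K a b x y]| <= _).
  apply/subset_leq_card/subsetP=> y; rewrite !inE /del_edge /b' /= => ->.
  have [xa|_] /= := eqVneq x a; last by case: (y =P a); case: (x == b).
  have [//|yb /=] := eqVneq y b; apply/negP=> /andP[/eqP xb /eqP ya].
  by rewrite ya -xa xb eqxx in yb.
by rewrite cardsU1; case: (_ \notin _); card_lia.
Qed.

Lemma end_fragment_del_edge a b X :
  a \notin X -> b \notin X -> end_fragment K X -> end_fragment (del_edge K a b) X.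
Proof.
move=> aX bX endX.
have eqN S : S \subset X -> neighbors (del_edge K a b) S = neighbors K S.
  move=> /subsetP SX; apply/setP=> y; rewrite !inE; congr (_ && _).
  apply: eq_existsb => x; rewrite /del_edge /=; have [/SX xX|//] := boolP (x \in S).
  have /negbTE-> : x != a by apply: contraNneq aX => <-.
  have /negbTE-> : x != b by apply: contraNneq bX => <-.
  by rewrite /= andbT.
have eqF S : S \subset X -> fragment (del_edge K a b) S = fragment K S.
  by move=> SX; rewrite /fragment eqN.
apply/minsetP; split; first by rewrite eqF // (minsetp endX).
by move=> S fS SX; apply: (end_fragment_min endX); rewrite -?eqF.
Qed.

End DeleteEdge.

(** * Augmenting a matching *)

Section Matchings.

Variables (T : finType) (e : rel T).
Hypotheses (sym_e : symmetric e) (irr_e : irreflexive e).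
Implicit Types (m : T -> T) (a b c u v w x y z : T) (A : {set T}).

(* A matching is encoded by the involution that swaps the ends of its edges and
   fixes the vertices it does not cover. *)
Definition matching_fun m := involutive m /\ forall x, m x != x -> e x (m x).

Definition matched m := [set x | m x != x].

(** At an uncovered [x] nothing is deleted, as [m x] is [x] and [e] has no loops. *)
Definition remainder m : rel T := [rel x y | e x y && (m x != y)].

Definition add_pair m a b z := if z == a then b else if z == b then a else m z.

Definition drop_pair m x z := if (z == x) || (z == m x) then z else m z.

Lemma remainder_sym m : involutive m -> symmetric (remainder m).
Proof.
move=> mK x y; rewrite /remainder /= sym_e; congr (_ && ~~ _).
by apply/eqP/eqP => <-; rewrite mK.
Qed.

Lemma remainder_irr m : irreflexive (remainder m).
Proof. by move=> x; rewrite /remainder /= irr_e. Qed.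

Lemma add_pair_matching m a b :
  matching_fun m -> m a = a -> m b = b -> e a b ->
  matching_fun (add_pair m a b) /\ #|matched (add_pair m a b)| = #|matched m|.+2.
Proof.
move=> [mK me] ma mb eab; have ab : a != b by apply: contraTneq eab => ->; rewrite irr_e.
have mz z c : m c = c -> m z = c -> z = c by move=> mc mzc; rewrite -(mK z) mzc.
split; last first.
  have -> : matched (add_pair m a b) = a |: (b |: matched m).
    apply/setP=> z; rewrite !inE /add_pair.
    case: (eqVneq z a) => [->|za]; first by rewrite eq_sym ab.
    by case: (eqVneq z b) => [->|zb //]; rewrite ab.
  by rewrite !cardsU1 !inE ma mb !eqxx (negbTE ab).
split=> z; rewrite /add_pair.
  case: (eqVneq z a) => [->|za]; first by rewrite eq_sym (negbTE ab) eqxx.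
  case: (eqVneq z b) => [->|zb]; first by rewrite eqxx.
  case: eqP => [/(mz _ _ ma)/eqP|_]; first by rewrite (negbTE za).
  by case: eqP => [/(mz _ _ mb)/eqP|_]; first by rewrite (negbTE zb).
case: (eqVneq z a) => [-> //|za]; case: (eqVneq z b) => [->|zb]; first by rewrite sym_e.
exact: me.
Qed.

Lemma drop_pair_matching m x :
  matching_fun m -> m x != x ->
  matching_fun (drop_pair m x) /\ #|matched m| = #|matched (drop_pair m x)|.+2.
Proof.
move=> [mK me] mx; split; last first.
  have -> : matched (drop_pair m x) = matched m :\ x :\ m x.
    apply/setP=> z; rewrite !inE /drop_pair.
    have [->|zx] := eqVneq z x; first by rewrite eqxx andbF.
    by have [->|zmx] := eqVneq z (m x); rewrite ?eqxx.
  rewrite (cardsD1 x (matched m)) inE mx (cardsD1 (m x) (_ :\ _)) !inE mK mx.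
  by rewrite eq_sym mx.
split=> z; rewrite /drop_pair.
  have [->|zx] := eqVneq z x; first by rewrite eqxx.
  have [->|zmx] := eqVneq z (m x); first by rewrite eqxx orbT.
  by rewrite /= (can_eq mK) (negbTE zx) orbF -[m z == x](can_eq mK) mK (negbTE zmx).
by case: ifP => [_|_ /me //]; rewrite eqxx.
Qed.

Variable m : T -> T.
Hypothesis (mM : matching_fun m).
Let H := remainder m.
Hypothesis (T2 : 2 < #|T|).
(** Maximality is stated against matchings with exactly one more edge, which is what every exchange
    below produces. *)
Hypothesis m_max : forall m', matching_fun m' -> #|matched m'| = #|matched m|.+2 ->
  ~~ biconnected (remainder m').

Let mK : involutive m. Proof. by case: mM. Qed.

Lemma free_edge_essential u v : m u = u -> m v = v -> e u v -> essential H u v.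
Proof.
move=> mu mv euv; have [mM' card'] := add_pair_matching mM mu mv euv.
apply: contra (m_max mM' card'); apply: sub_biconnected => x y.
rewrite /del_edge /H /remainder /add_pair /= => /andP[/andP[-> mxy]].
rewrite !(eq_sym y); have [_|_] := eqVneq x u; first by case: eqP.
by have [_|//] := eqVneq x v; rewrite orbC; case: eqP.
Qed.

(** * Exchange along the path [u], [x], [m x], [v] *)

Section Augment3.

Variables x u v : T.
Hypotheses (mx : m x != x) (mu : m u = u) (mv : m v = v) (uv : u != v).
Hypotheses (eux : e u x) (evy : e v (m x)).

Let m' := add_pair (add_pair (drop_pair m x) u x) v (m x).

Let ux : u != x. Proof. by apply: contraNneq mx => <-; rewrite mu. Qed.
Let vx : v != x. Proof. by apply: contraNneq mx => <-; rewrite mv. Qed.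
Let uy : u != m x. Proof. by rewrite -mu (can_eq mK) ux. Qed.

Lemma augment3_matching :
  matching_fun m' /\ #|matched m'| = #|matched m|.+2.
Proof.
have [dM dcard] := drop_pair_matching mM mx.
have du : drop_pair m x u = u by rewrite /drop_pair mu if_same.
have dx : drop_pair m x x = x by rewrite /drop_pair eqxx.
have [aM acard] := add_pair_matching dM du dx eux.
have av : add_pair (drop_pair m x) u x v = v.
  by rewrite /add_pair /drop_pair mv eq_sym (negbTE uv) (negbTE vx) if_same.
have ay : add_pair (drop_pair m x) u x (m x) = m x.
  by rewrite /add_pair /drop_pair eq_sym (negbTE uy) (negbTE mx) eqxx orbT.
have [mM' mcard] := add_pair_matching aM av ay evy.
by split=> //; rewrite mcard acard dcard.
Qed.

Lemma augment3_remainder a b :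
  H a b -> ~~ ((a == u) && (b == x) || (a == x) && (b == u)) ->
  ~~ ((a == v) && (b == m x) || (a == m x) && (b == v)) -> remainder m' a b.
Proof.
rewrite /H /remainder /m' /add_pair /= => /andP[eab mab]; rewrite eab /=.
rewrite !(eq_sym b); have [_|_] := eqVneq a v; first by case: (m x =P b).
have [_|_] := eqVneq a (m x); first by case: (v =P b); rewrite ?orbT.
have [_|_] := eqVneq a u; first by case: (x =P b).
have [_|_ _ _] := eqVneq a x; first by case: (u =P b); rewrite ?orbT.
have ab : a != b by apply: contraTneq eab => ->; rewrite irr_e.
by rewrite /drop_pair; case: ifP.
Qed.

Lemma augment3_old_pair : remainder m' x (m x).
Proof.
have [_ me] := mM; rewrite /remainder /m' /add_pair /drop_pair /= me //=.
by rewrite (eq_sym x v) (negbTE vx) (eq_sym x) (negbTE mx) (eq_sym x) (negbTE ux) eqxx.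
Qed.

(** The new remainder contains [H] without the two new matching edges; the returned edge [x (m x)]
    is disregarded. *)
Lemma augment3_not_biconnected :
  ~~ biconnected (del_edge (del_edge H u x) v (m x)).
Proof.
have [mM' card'] := augment3_matching; apply: contra (m_max mM' card').
apply: sub_biconnected => a b /andP[/andP[Hab n1] n2]; exact: augment3_remainder.
Qed.

(* If [u x] and [v (m x)] crossed the same separation, then so would [u (m x)] or
   [x (m x)]. *)
Lemma augment3_triangle : e u (m x) -> essential H u x \/ essential H v (m x).
Proof.
move=> euy; apply/orP; rewrite -negb_and; apply/negP=> /andP[cux cvy].
have [mM' card'] := augment3_matching.
have [w [A [wA A0 B0 nK]]] := not_biconnected T2 (m_max mM' card').
have sepN a b : remainder m' a b -> remainder m' b a ->
   ~ (a \in A /\ (b \notin A) && (b != w) \/ b \in A /\ (a \notin A) && (a != w)).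
  by move=> Rab Rba [] [aA /andP[bA bw]];
     [move: (nK _ _ aA bA bw) | move: (nK _ _ aA bA bw)]; rewrite ?Rab ?Rba.
have symR := remainder_sym mM'.1.
have Ruy : remainder m' u (m x).
  apply: augment3_remainder.
  - by rewrite /H /remainder /= euy mu.
  - by rewrite eqxx (negbTE mx) (negbTE ux).
  - by rewrite (negbTE uv) (negbTE uy).
have cross a b : biconnected (del_edge H a b) ->
    exists a1 b1, [/\ a1 \in A, b1 \notin A, b1 != w & del_edge H a b a1 b1].
  move=> cH; case/set0Pn: (A0) => s sA; case/set0Pn: (B0) => t.
  by rewrite !inE negb_or => /andP[tw tA]; apply: (biconnected_edge cH wA sA tA tw).
(* As [u x] alone can be deleted, another edge of [H] crosses the separation, and it must be
   [v (m x)]; likewise [u x] crosses it. *)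
have [a [b [aA bA bw /andP[Hab nab]]]] := cross _ _ cux.
have [a' [b' [aA' bA' bw' /andP[Hab' nab']]]] := cross _ _ cvy.
have : (a == v) && (b == m x) || (a == m x) && (b == v).
  by apply: contraNT (nK a b aA bA bw); apply: augment3_remainder.
have : (a' == u) && (b' == x) || (a' == x) && (b' == u).
  by apply: contraNT (nK a' b' aA' bA' bw') => n; apply: augment3_remainder.
have Rxy := augment3_old_pair.
case/orP=> /andP[/eqP ? /eqP ?]; case/orP=> /andP[/eqP ? /eqP ?]; subst a a' b b'.
- by move: (nK _ _ aA' bA bw); rewrite Ruy.
- by move: (nK _ _ aA bA' bw'); rewrite symR Rxy.
- by move: (nK _ _ aA' bA bw); rewrite Rxy.
- by move: (nK _ _ aA bA' bw'); rewrite symR Ruy.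
Qed.

End Augment3.

(** * Exchange along the path [u], [x1], [m x1], [m x2], [x2], [v] *)

Section Augment5.

Variables x1 x2 u v : T.
Hypotheses (mx1 : m x1 != x1) (mx2 : m x2 != x2) (x12 : x1 != x2) (y12 : m x1 != x2).
Hypotheses (mu : m u = u) (mv : m v = v) (uv : u != v).
Hypotheses (eux : e u x1) (evx : e v x2) (eyy : e (m x1) (m x2)).

Let d := drop_pair (drop_pair m x1) x2.
Let m' := add_pair (add_pair (add_pair d u x1) v x2) (m x1) (m x2).

Let fixN a z : m a = a -> m z != z -> a != z.
Proof. by move=> ma; apply: contraNneq => <-; rewrite ma. Qed.
Let my1 : m (m x1) != m x1. Proof. by rewrite (can_eq mK). Qed.
Let my2 : m (m x2) != m x2. Proof. by rewrite (can_eq mK). Qed.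
Let x1y2 : x1 != m x2. Proof. by rewrite -(can_eq mK) mK. Qed.
Let d2 : drop_pair m x1 x2 = m x2.
Proof. by rewrite /drop_pair !(eq_sym x2) (negbTE x12) (negbTE y12). Qed.

Lemma augment5_matching :
  matching_fun m' /\ #|matched m'| = #|matched m|.+2.
Proof.
have [dM dcard] := drop_pair_matching mM mx1.
have dx2 : drop_pair m x1 x2 != x2 by rewrite d2.
have [ddM ddcard] := drop_pair_matching dM dx2.
have dfix a : m a = a -> d a = a.
  by move=> ma; rewrite /d /drop_pair ma !if_same.
have dx a : a \in [:: x1; m x1; x2; m x2] -> d a = a.
  rewrite /d {1}/drop_pair d2 !inE.
  case/or4P=> /eqP->; rewrite ?eqxx ?orbT //; case: ifP => // _;
  by rewrite /drop_pair eqxx ?orbT.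
have [aM acard] := add_pair_matching ddM (dfix u mu) (dx x1 (mem_head _ _)) eux.
have av : add_pair d u x1 v = v.
  by rewrite /add_pair eq_sym (negbTE uv) (negbTE (fixN mv mx1)) dfix.
have ax2 : add_pair d u x1 x2 = x2.
  by rewrite /add_pair !(eq_sym x2) (negbTE (fixN mu mx2)) (negbTE x12) dx // !inE eqxx !orbT.
have [bM bcard] := add_pair_matching aM av ax2 evx.
have by1 : add_pair (add_pair d u x1) v x2 (m x1) = m x1.
  rewrite /add_pair eq_sym (negbTE (fixN mv my1)) (negbTE y12) eq_sym (negbTE (fixN mu my1)).
  by rewrite (negbTE mx1) dx // !inE eqxx orbT.
have by2 : add_pair (add_pair d u x1) v x2 (m x2) = m x2.
  rewrite /add_pair eq_sym (negbTE (fixN mv my2)) (negbTE mx2) eq_sym (negbTE (fixN mu my2)).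
  by rewrite eq_sym (negbTE x1y2) dx // !inE eqxx !orbT.
have [mM' mcard] := add_pair_matching bM by1 by2 eyy.
by split=> //; rewrite mcard bcard acard dcard ddcard.
Qed.

Lemma augment5_remainder a b :
  H a b -> ~~ ((a == u) && (b == x1) || (a == x1) && (b == u)) ->
  ~~ ((a == v) && (b == x2) || (a == x2) && (b == v)) ->
  ~~ ((a == m x1) && (b == m x2) || (a == m x2) && (b == m x1)) -> remainder m' a b.
Proof.
rewrite /H /remainder /m' /add_pair /= => /andP[eab mab]; rewrite eab !(eq_sym b) /=.
have [_|_] := eqVneq a (m x1); first by case: (m x2 =P b).
have [_|_] := eqVneq a (m x2); first by case: (m x1 =P b); rewrite ?orbT.
have [_|_] := eqVneq a v; first by case: (x2 =P b).
have [_|_] := eqVneq a x2; first by case: (v =P b); rewrite ?orbT.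
have [_|_] := eqVneq a u; first by case: (x1 =P b).
have [_|_ _ _ _] := eqVneq a x1; first by case: (u =P b); rewrite ?orbT.
have ab : a != b by apply: contraTneq eab => ->; rewrite irr_e.
by rewrite /d /drop_pair; do 2!case: ifP => _ //.
Qed.

(* Both [u x1] and [v x2] would have to cross the separation, and then its
   vertex would be [c] as well as [c']. *)
Lemma augment5_not_biconnected c c' :
  c != c' -> H x1 x2 -> H u c -> H c x1 -> H v c' -> H c' x2 ->
  biconnected (del_edge (del_edge H (m x1) (m x2)) u x1) ->
  biconnected (del_edge (del_edge H (m x1) (m x2)) v x2) -> False.
Proof.
move=> cc' H12 Huc Hcx Hvc' Hcx' c1 c2.
have [mM' card'] := augment5_matching.
have [w [A [wA A0 B0 nK]]] := not_biconnected T2 (m_max mM' card').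
have symR := remainder_sym mM'.1; have irrH : irreflexive H := @remainder_irr m.
have fx z : m z = z -> [/\ z != x1, z != x2, z != m x1 & z != m x2].
  by move=> mz; split; apply: fixN.
have [ux1 ux2 uy1 uy2] := fx u mu; have [vx1 vx2 vy1 vy2] := fx v mv.
have ne p q : H p q -> p != q by move=> Hpq; apply: contraTneq Hpq => ->; rewrite irrH.
have x21 : x2 != x1 by rewrite eq_sym.
have R12 : remainder m' x1 x2.
  apply: augment5_remainder => //.
  - by rewrite (eq_sym x1) (negbTE ux1) (eq_sym x2 u) (negbTE ux2) andbF.
  - by rewrite (eq_sym x1 v) (negbTE vx1) (negbTE x12).
  - by rewrite (negbTE x1y2) (eq_sym x1) (negbTE mx1).
have Ruc : remainder m' u c.
  apply: augment5_remainder => //.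
  - by rewrite (negbTE ux1) eqxx (negbTE (ne _ _ Hcx)).
  - by rewrite (negbTE uv) (negbTE ux2).
  - by rewrite (negbTE uy1) (negbTE uy2).
have Rcx : remainder m' c x1.
  apply: augment5_remainder => //.
  - by rewrite eq_sym (negbTE (ne _ _ Huc)) (eq_sym x1) (negbTE ux1) andbF.
  - by rewrite (negbTE x12) (eq_sym x1) (negbTE vx1) !andbF.
  - by rewrite (negbTE x1y2) (eq_sym x1) (negbTE mx1) !andbF.
have Rvc : remainder m' v c'.
  apply: augment5_remainder => //.
  - by rewrite eq_sym (negbTE uv) (negbTE vx1).
  - by rewrite (negbTE vx2) eqxx (negbTE (ne _ _ Hcx')).
  - by rewrite (negbTE vy1) (negbTE vy2).
have Rcx' : remainder m' c' x2.
  apply: augment5_remainder => //.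
  - by rewrite (negbTE x21) (eq_sym x2) (negbTE ux2) !andbF.
  - by rewrite eq_sym (negbTE (ne _ _ Hvc')) (eq_sym x2) (negbTE vx2) andbF.
  - by rewrite (eq_sym x2) (negbTE mx2) (eq_sym x2) (negbTE y12) !andbF.
(* A common neighbor of two vertices on opposite sides is the separating vertex; this will identify
   both [c] and [c'] with [w]. *)
have mid p q r : p \in A -> q \notin A -> q != w -> remainder m' p r ->
    remainder m' r q -> r = w.
  move=> pA qA qw Rpr Rrq; apply/eqP; apply: contraT => rw.
  have [rA|rA] := boolP (r \in A); first by move: (nK _ _ rA qA qw); rewrite Rrq.
  by move: (nK _ _ pA rA rw); rewrite Rpr.
have cross a b : biconnected (del_edge (del_edge H (m x1) (m x2)) a b) ->
    exists a1 b1, [/\ a1 \in A, b1 \notin A, b1 != w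
      & del_edge (del_edge H (m x1) (m x2)) a b a1 b1].
  move=> cH; case/set0Pn: (A0) => s sA; case/set0Pn: (B0) => t.
  by rewrite !inE negb_or => /andP[tw tA]; apply: (biconnected_edge cH wA sA tA tw).
have [a [b [aA bA bw /andP[/andP[Hab nyy] nab]]]] := cross _ _ c1.
have [a' [b' [aA' bA' bw' /andP[/andP[Hab' nyy'] nab']]]] := cross _ _ c2.
have : (a == v) && (b == x2) || (a == x2) && (b == v).
  by apply: contraNT (nK a b aA bA bw) => n; apply: augment5_remainder.
have : (a' == u) && (b' == x1) || (a' == x1) && (b' == u).
  by apply: contraNT (nK a' b' aA' bA' bw') => n; apply: augment5_remainder.
have R21 : remainder m' x2 x1 by rewrite symR.
have Rxc : remainder m' x1 c by rewrite symR.
have Rcu : remainder m' c u by rewrite symR.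
have Rxc' : remainder m' x2 c' by rewrite symR.
have Rcv : remainder m' c' v by rewrite symR.
case/orP=> /andP[/eqP ? /eqP ?]; case/orP=> /andP[/eqP ? /eqP ?]; subst a a' b b'.
- by move: cc'; rewrite (mid _ _ _ aA' bA' bw' Ruc Rcx) (mid _ _ _ aA bA bw Rvc Rcx') eqxx.
- by move: (nK _ _ aA bA' bw'); rewrite R21.
- by move: (nK _ _ aA' bA bw); rewrite R12.
- by move: cc'; rewrite (mid _ _ _ aA' bA' bw' Rxc Rcu) (mid _ _ _ aA bA bw Rxc' Rcv) eqxx.
Qed.

End Augment5.

End Matchings.

(** * Counting around two remote ends *)

Section Maximum.

Variables (d : nat) (T : finType) (e : rel T) (m : T -> T).
Hypotheses (d5 : 5 <= d) (sym_e : symmetric e) (irr_e : irreflexive e).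
Hypotheses (deg_e : forall x, d <= degree e x) (T2d : 2 * d <= #|T|).
Hypothesis mM : matching_fun e m.
Let H := remainder e m.
Let M := matched m.
Hypotheses (cH : biconnected H) (M_even : ~~ odd #|M|) (M_lt : #|M| < 2 * d).
Hypothesis m_max : forall m', matching_fun e m' -> #|matched m'| = #|matched m|.+2 ->
  ~~ biconnected (remainder e m').
Implicit Types (a b c u v w x y z p q : T) (A X Y : {set T}).

Let mK : involutive m. Proof. by case: mM. Qed.
Let symH : symmetric H. Proof. exact: (remainder_sym sym_e mK). Qed.
Let irrH : irreflexive H. Proof. exact: remainder_irr. Qed.
Let T2 : 2 < #|T|. Proof. exact: biconnected_gt2 cH. Qed.

Let freeE u : (u \notin M) = (m u == u). Proof. by rewrite inE negbK. Qed.

Let mM_in x : (m x \in M) = (x \in M).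
Proof. by rewrite !inE (can_eq mK). Qed.

Let free_rem u z : u \notin M -> H u z = e u z.
Proof.
rewrite freeE /H /remainder /= => /eqP->; case: eqVneq => [<-|]; rewrite ?andbT //.
by rewrite irr_e.
Qed.

Lemma degree_remainder x : d <= (degree H x).+1.
Proof.
apply: leq_trans (deg_e x) _; rewrite !degreeE.
apply: leq_trans (_ : #|m x |: [set y | H x y]| <= _).
  apply/subset_leq_card/subsetP=> y; rewrite !inE /H /remainder /= eq_sym => ->.
  by case: eqP.
by rewrite cardsU1; case: (_ \notin _); card_lia.
Qed.

Lemma degree_remainder_gt3 x : 3 < degree H x.
Proof. by move: (degree_remainder x) d5; card_lia. Qed.

Let deg3 x : 2 < degree H x. Proof. exact: ltnW (degree_remainder_gt3 x). Qed.

Let S u := [set z in M | e u z].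

(** The partners of [S u :&: S v] and the set [S u :|: S v] are too many to be disjoint in [M]. So a
    common neighbor [y] has its partner adjacent to [u] or [v], which is the triangle of
    [augment3_triangle]. *)
Lemma triangle_essential u v :
  u \notin M -> v \notin M -> u != v -> #|M| < #|S u| + #|S v| ->
  exists2 z, z \in M & e u z && essential H u z || e v z && essential H v z.
Proof.
rewrite !freeE => /eqP mu /eqP mv uv ltM.
have [y] : exists y, y \in (S u :&: S v) :&: [set y | m y \in S u :|: S v].
  apply/set0Pn; apply: contraTneq ltM => I0; rewrite -leqNgt -cardsUI.
  rewrite -(card_imset (mem (S u :&: S v)) (can_inj mK)).
  have dis : [disjoint S u :|: S v & [set m x | x in S u :&: S v]].
    rewrite disjoint_sym disjoint_subset; apply/subsetP=> _ /imsetP[x xS ->].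
    rewrite inE; apply/negP=> mxS.
    by have := in_set0 x; rewrite -I0 inE xS inE mxS.
  rewrite -cardsUI (_ : (_ :|: _) :&: _ = set0) ?cards0 ?addn0; last first.
    by apply/eqP; rewrite setI_eq0.
  apply/subset_leq_card/subsetP=> x; rewrite in_setU => /orP[|/imsetP[t]].
    by rewrite !inE => /orP[] /andP[].
  by rewrite in_setI => /andP[]; rewrite inE => /andP[tM _] _ ->; rewrite mM_in.
rewrite !inE => /andP[/andP[/andP[my euy] /andP[_ evy]]].
rewrite (can_eq mK) my /= => /orP[] e_my.
  have mmy : m (m y) != m y by rewrite (can_eq mK).
  have evmy : e v (m (m y)) by rewrite mK.
  have eumy : e u (m (m y)) by rewrite mK.
  have [ess|] := augment3_triangle sym_e irr_e mM T2 m_max mmy mu mv uv e_my evmy eumy.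
    by exists (m y); rewrite ?inE ?mmy // e_my ess.
  by rewrite mK => ess; exists y; rewrite ?inE ?my // evy ess orbT.
have mmy : m (m y) != m y by rewrite (can_eq mK).
have evmy : e v (m (m y)) by rewrite mK.
have eumy : e u (m (m y)) by rewrite mK.
have vu : v != u by rewrite eq_sym.
have [ess|] := augment3_triangle sym_e irr_e mM T2 m_max mmy mv mu vu e_my eumy evmy.
  by exists (m y); rewrite ?inE ?mmy // e_my ess orbT.
by rewrite mK => ess; exists y; rewrite ?inE ?my // euy ess.
Qed.

Definition remote_ends X Y : Prop :=
  [/\ end_fragment H X, end_fragment H Y
    & forall x y, x \in X -> y \in Y -> x != y /\ ~~ H x y].

Lemma remote_endsC X Y : remote_ends X Y -> remote_ends Y X.
Proof.
by case=> endX endY sep; split=> // x y xX yY; rewrite eq_sym symH; apply: sep.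
Qed.

Lemma matched_lt : #|M| + 2 <= 2 * d.
Proof. by move: M_even M_lt; rewrite mul2n; card_lia. Qed.

Lemma two_free : 1 < #|~: M|.
Proof. by move: (cardsC M) matched_lt T2d; card_lia. Qed.

Lemma free_essential u v : u \notin M -> v \notin M -> H u v -> essential H u v.
Proof.
move=> uM vM; rewrite free_rem // => euv; rewrite !freeE in uM vM.
exact: (free_edge_essential sym_e irr_e mM m_max (eqP uM) (eqP vM) euv).
Qed.

Lemma card_matched_neighbors u : u \notin M ->
  d <= #|S u| + #|[set z in ~: M | H u z]|.
Proof.
move=> uM; apply: leq_trans (deg_e u) _; rewrite degreeE.
rewrite -cardsUI -[leqLHS]addn0 leq_add // ; apply/subset_leq_card/subsetP=> z.
by rewrite !inE free_rem // => ->; case: (m z == z).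
Qed.

(** An edge between free vertices is essential. If there is none, any two free vertices have at
    least [d] covered neighbors each, more than [#|M|] together. *)
Lemma exists_remote_ends : exists X Y, remote_ends X Y.
Proof.
suff [a [b [Hab ess]]] : exists a b, H a b /\ essential H a b.
  exact: (essential_ends symH irrH cH deg3 Hab ess).
have [u [v [uM vM uv]]] := card_gt1P two_free.
rewrite !in_setC in uM vM.
have [euv|neuv] := boolP [exists u, exists v, [&& u \notin M, v \notin M & H u v]].
  case/existsP: euv => a /existsP[b /and3P[aM bM Hab]].
  by exists a, b; split=> //; apply: free_essential.
have noF t : t \notin M -> d <= #|S t|.
  move=> tM; move: (card_matched_neighbors tM).
  have -> : [set z in ~: M | H t z] = set0; last by rewrite cards0 addn0.
  apply/setP=> z; rewrite in_set0 inE in_setC; apply: contraNF neuv => /andP[zM Htz].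
  by apply/existsP; exists t; apply/existsP; exists z; rewrite tM zM.
have ltM : #|M| < #|S u| + #|S v| by move: (noF u uM) (noF v vM) M_lt; card_lia.
have [z zM] := triangle_essential uM vM uv ltM.
by case/orP=> /andP[etz ess]; [exists u, z | exists v, z]; rewrite free_rem.
Qed.

(** * Free vertices and exchanges at two remote ends *)

Section RemoteEnds.

Variables X Y : {set T}.
Hypothesis XY : remote_ends X Y.

Lemma end_in_union x y : x \in X -> H x y -> y \in X :|: neighbors H X.
Proof.
move=> xX Hxy; rewrite in_setU; have [//|yX] := boolP (y \in X).
exact: (neighborsI xX yX Hxy).
Qed.

Lemma end_not_essential a z : z \in X :|: Y -> H a z -> ~~ essential H a z.
Proof.
have [endX endY _] := XY; rewrite in_setU essentialC symH.
case/orP=> zE Hza; first exact: (end_fragment_not_essential symH irrH cH deg3 endX zE Hza).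
exact: (end_fragment_not_essential symH irrH cH deg3 endY zE Hza).
Qed.

Lemma end_free_matched u : u \in X :|: Y -> u \notin M -> d <= #|S u|.
Proof.
move=> uXY uM; move: (card_matched_neighbors uM).
have -> : [set z in ~: M | H u z] = set0; last by rewrite cards0 addn0.
apply/setP=> z; rewrite in_set0 inE in_setC; apply/negP => /andP[zM Huz].
rewrite symH in Huz; move: (end_not_essential uXY Huz).
by rewrite free_essential.
Qed.

(** Two such vertices would have [d] covered neighbors each, and [triangle_essential] would put an
    essential edge at an end. *)
Lemma ends_free_eq u v :
  u \in X :|: Y -> v \in X :|: Y -> u \notin M -> v \notin M -> u = v.
Proof.
move=> uXY vXY uM vM; apply/eqP/negPn/negP=> uv.
have ltM : #|M| < #|S u| + #|S v|.
  by move: (end_free_matched uXY uM) (end_free_matched vXY vM) M_lt; card_lia.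
have [z zM] := triangle_essential uM vM uv ltM.
have no t : t \in X :|: Y -> t \notin M -> e t z -> ~~ essential H t z.
  by move=> tXY tM etz; rewrite essentialC end_not_essential // symH free_rem.
by case/orP=> /andP[/no/negbTE->].
Qed.

Lemma card_end_neighbors : #|neighbors H X| = 2.
Proof. by have [/minsetp/and3P[_ /eqP]] := XY. Qed.

Lemma end_degree x : x \in X -> degree H x <= #|X|.+1.
Proof.
move=> xX; apply: leq_trans (_ : #|(X :\ x) :|: neighbors H X| <= _).
  apply: degree_sub => y Hxy; rewrite in_setU in_setD1.
  have := end_in_union xX Hxy; rewrite in_setU.
  by case: eqP Hxy => [->|//]; rewrite irrH.
apply: leq_trans (leq_card_setU _ _) _; rewrite card_end_neighbors.
by move: (cardsD1 x X); rewrite xX; card_lia.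
Qed.

Lemma card_end_matched : d <= #|X :&: M| + 2.
Proof.
have [/minsetp/and3P[/set0Pn[x xX] _ _] _ _] := XY.
have [/setIidPl->|/subsetPn[u uX uM]] := boolP (X \subset M).
  by move: (degree_remainder x) (end_degree xX); card_lia.
have XM : #|X :\: M| <= 1.
  apply/card_le1_eqP => y z; rewrite !in_setD => /andP[yM yX] /andP[zM zX].
  by apply: ends_free_eq; rewrite // in_setU ?yX ?zX.
(* A free vertex keeps its full degree in [H]; this makes up for its not being counted in
   [X :&: M]. *)
have le_d : d <= #|X|.+1.
  apply: leq_trans (end_degree uX); apply: leq_trans (deg_e u) _.
  by apply: subset_leq_card; apply/subsetP=> z; rewrite !inE free_rem.
by move: (cardsID M X) XM le_d; card_lia.
Qed.

(* Deleting [u x] leaves [Y] an end, so that [v (m x)] can be deleted next. *)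
Lemma end_flip u v x : u \notin M -> v \notin M -> u != v ->
  x \in X -> m x \in Y -> e u x -> e v (m x) -> False.
Proof.
move=> uM vM uv xX mxY eux evy; have [endX endY sep] := XY.
have mx : m x != x by rewrite eq_sym; have [] := sep _ _ xX mxY.
have Hux : H u x by rewrite free_rem.
have Hvy : H v (m x) by rewrite free_rem.
have uY : u \notin Y.
  by apply/negP=> uY; have [_] := sep _ _ xX uY; rewrite symH Hux.
have xY : x \notin Y by apply/negP=> xY; have [] := sep _ _ xX xY; rewrite eqxx.
have := uM; have := vM; rewrite !freeE => /eqP mv /eqP mu.
have /negP[] := augment3_not_biconnected sym_e irr_e mM m_max mx mu mv uv eux evy.
have c1 : biconnected (del_edge H u x).
  by rewrite -[biconnected _]negbK end_not_essential // in_setU xX.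
have deg1 z : 2 < degree (del_edge H u x) z.
  by move: (degree_remainder_gt3 z) (degree_del_edge H u x z); card_lia.
have end1 := end_fragment_del_edge uY xY endY.
have irr1 : irreflexive (del_edge H u x) by move=> z; rewrite /del_edge /= irrH.
have := end_fragment_not_essential (del_edge_sym _ _ symH) irr1 c1 deg1 end1 mxY.
move=> /(_ v); rewrite essentialC negbK; apply.
rewrite /del_edge /= symH Hvy (negbTE mx) /= orbF negb_and; apply/orP; left.
by apply: contraNneq uY => <-.
Qed.

Lemma end_triangle u v x : u \notin M -> v \notin M -> u != v ->
  x \in M -> x \in X -> m x \in X -> e u x -> e u (m x) -> e v (m x) -> False.
Proof.
move=> uM vM uv xM xX yX eux euy evy.
have := uM; have := vM; have := xM; rewrite !freeE inE => mx /eqP mv /eqP mu.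
have [] := augment3_triangle sym_e irr_e mM T2 m_max mx mu mv uv eux evy euy; apply/negP;
  by rewrite end_not_essential // ?free_rem // in_setU ?xX ?yX.
Qed.

(** Deleting [(m x1) (m x2)], which touches only [Y], leaves [X] an end, so that either of [u x1]
    and [v x2] can be deleted next. *)
Lemma end_augment5 x1 x2 u v c c' : u \notin M -> v \notin M -> u != v ->
  x1 \in X -> x2 \in X -> m x1 \in Y -> m x2 \in Y -> H x1 x2 -> H (m x1) (m x2) ->
  c != c' -> H u c -> H c x1 -> H v c' -> H c' x2 -> e u x1 -> e v x2 -> False.
Proof.
move=> uM vM uv x1X x2X y1Y y2Y H12 Hyy cc' Huc Hcx Hvc Hcx' eux evx.
have [endX endY sep] := XY.
have mx1 : m x1 != x1 by rewrite eq_sym; have [] := sep _ _ x1X y1Y.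
have mx2 : m x2 != x2 by rewrite eq_sym; have [] := sep _ _ x2X y2Y.
have x12 : x1 != x2 by apply: contraTneq H12 => ->; rewrite irrH.
have y12 : m x1 != x2 by rewrite eq_sym; have [] := sep _ _ x2X y1Y.
have := uM; have := vM; rewrite !freeE => /eqP mv /eqP mu.
have eyy : e (m x1) (m x2) by case/andP: Hyy.
have notX y : y \in Y -> y \notin X.
  by move=> yY; apply/negP=> yX; have [] := sep _ _ yX yY; rewrite eqxx.
have c1 : biconnected (del_edge H (m x1) (m x2)).
  by rewrite -[biconnected _]negbK end_not_essential // in_setU y2Y orbT.
have deg1 z : 2 < degree (del_edge H (m x1) (m x2)) z.
  by move: (degree_remainder_gt3 z) (degree_del_edge H (m x1) (m x2) z); card_lia.
have end1 := end_fragment_del_edge (notX _ y1Y) (notX _ y2Y) endX.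
have irr1 : irreflexive (del_edge H (m x1) (m x2)) by move=> z; rewrite /del_edge /= irrH.
have sym1 := del_edge_sym (m x1) (m x2) symH.
have KL a z : a \notin M -> e a z -> z \in X ->
    biconnected (del_edge (del_edge H (m x1) (m x2)) a z).
  move=> aM eaz zX; have := end_fragment_not_essential sym1 irr1 c1 deg1 end1 zX.
  move=> /(_ a); rewrite essentialC negbK; apply.
  have zy1 : z != m x1 by apply: contraTneq zX => ->; apply: notX.
  have zy2 : z != m x2 by apply: contraTneq zX => ->; apply: notX.
  by rewrite /del_edge /= symH free_rem // eaz (negbTE zy1) (negbTE zy2).
apply: (augment5_not_biconnected sym_e irr_e mM T2 m_max mx1 mx2 x12 y12 mu mv uv
  eux evx eyy cc' H12 Huc Hcx Hvc Hcx'); exact: KL.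
Qed.

End RemoteEnds.

(** * Distribution of the covered vertices over the ends *)

Let W X Y := M :\: (X :|: Y).

Lemma card_matched_split X Y : remote_ends X Y ->
  #|X :&: M| + #|Y :&: M| + #|W X Y| = #|M|.
Proof.
case=> _ _ sep; rewrite -(cardsID X M) -(cardsID Y (M :\: X)) /W setDDl addnA.
congr (_ + _ + _); first by rewrite setIC.
apply: eq_card => y; rewrite !inE.
case yY: (y \in Y) => /=; rewrite ?andbF ?andbT //.
by rewrite (_ : y \notin X) //; apply/negP=> yX; have [] := sep _ _ yX yY; rewrite eqxx.
Qed.

Lemma end_neighbor_notin X Y p : remote_ends X Y -> p \in neighbors H X ->
  p \notin X :|: Y.
Proof.
case=> _ _ sep /neighborsP[pX [x xX Hxp]]; rewrite in_setU negb_or pX.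
by apply/negP=> pY; have [_] := sep _ _ xX pY; rewrite Hxp.
Qed.

Lemma in_rest X Y z : z \in M -> (z \in W X Y) = (z \notin X :|: Y).
Proof. by move=> zM; rewrite in_setD zM andbT. Qed.

Lemma free_neighbor X Y u z : remote_ends X Y -> u \notin X :|: Y -> u \notin M ->
  z \in X :|: Y -> e u z -> u \in neighbors H X :|: neighbors H Y.
Proof.
move=> _; rewrite in_setU negb_or => /andP[uX uY] uM; rewrite !in_setU => zXY.
rewrite -free_rem // symH => Hzu; apply/orP.
by case/orP: zXY => zE; [left|right]; apply: neighborsI zE _ Hzu.
Qed.

(** Edges between free vertices are essential, so two free vertices have at most one free neighbor
    each. *)
Lemma free_leaves : exists l1 l2,
  [/\ l1 \notin M, l2 \notin M, l1 != l2, d <= #|S l1|.+1 & d <= #|S l2|.+1].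
Proof.
have essU : {in ~: M &, forall a b, H a b -> essential H a b}.
  by move=> a b; rewrite !in_setC; apply: free_essential.
have [l1 [l2 []]] := essential_leaves symH irrH cH deg3 essU two_free.
rewrite !in_setC => l1M l2M l12 n1 n2; exists l1, l2; split=> //.
  by move: (card_matched_neighbors l1M) n1; card_lia.
by move: (card_matched_neighbors l2M) n2; card_lia.
Qed.

(** For a smaller [M], the two leaves give an essential edge, whose covered end is outside both
    ends. Then [#|M|] is at least [2 d - 3], and parity excludes this. *)
Lemma card_matched X Y : remote_ends X Y -> #|M| + 2 = 2 * d.
Proof.
move=> XY; have [l1 [l2 [l1M l2M l12 n1 n2]]] := free_leaves.
apply/eqP; rewrite eqn_leq matched_lt /= leqNgt; apply/negP=> ltM.
have ltS : #|M| < #|S l1| + #|S l2| by move: n1 n2 ltM; card_lia.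
have [z zM ess] := triangle_essential l1M l2M l12 ltS.
have W1 : 0 < #|W X Y|.
  apply/card_gt0P; exists z; rewrite in_rest //; apply/negP=> zXY.
  have no t : t \notin M -> e t z -> ~~ essential H t z.
    by move=> tM etz; rewrite (end_not_essential XY) ?free_rem.
  by case/orP: ess => /andP[/no/negbTE->].
move: (card_matched_split XY) (card_end_matched XY) (card_end_matched (remote_endsC XY)).
by move: W1 ltM M_even; card_lia.
Qed.

(* At the least possible size [d - 2] of an end, the degrees in [H], which are at
   least [d - 1], leave no room for a missing edge. *)
Lemma tight_end X Y x : remote_ends X Y -> #|X| + 2 = d -> x \in X ->
  (forall z, z \in X :|: neighbors H X -> z != x -> H x z)
  /\ m x \notin X :|: neighbors H X.
Proof.
move=> XY Xd xX.
have sub : [set y | H x y] \subset (X :|: neighbors H X) :\ x.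
  apply/subsetP=> y; rewrite inE in_setD1 => Hxy; rewrite (end_in_union xX Hxy) andbT.
  by apply: contraTneq Hxy => ->; rewrite irrH.
have eqN : [set y | H x y] = (X :|: neighbors H X) :\ x.
  apply/eqP; rewrite eqEcard sub /= -degreeE.
  move: (cardsD1 x (X :|: neighbors H X)) (leq_card_setU X (neighbors H X)).1.
  rewrite in_setU xX (card_end_neighbors XY) /=.
  by move: (degree_remainder x) Xd; card_lia.
have adj z : z \in X :|: neighbors H X -> z != x -> H x z.
  by move=> zE zx; have := in_setD1 z (X :|: neighbors H X) x; rewrite -eqN inE zE zx.
split=> //; apply/negP=> mxE; have [mx|mx] := eqVneq (m x) x; last first.
  by have := adj _ mxE mx; rewrite /H /remainder /= eqxx andbF.
have xM : x \notin M by rewrite freeE mx.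
have : degree e x <= degree H x.
  by apply/subset_leq_card/subsetP=> y; rewrite !inE free_rem.
by move: (deg_e x) (end_degree XY xX) Xd; card_lia.
Qed.

(** A free [u] in [X] needs [d] covered neighbors, which makes [X] and its neighbors take so many
    that [Y] is tight; flips at [Y] then bound the neighbors of [u]. *)
Lemma no_free_in_end X Y u : remote_ends X Y -> u \in X -> u \in M.
Proof.
move=> XY uX; have [endX endY sep] := XY; apply/negPn/negP=> uM.
have uXY : u \in X :|: Y by rewrite in_setU uX.
have YX := remote_endsC XY.
have YM : Y \subset M.
  apply/subsetP=> y yY; apply/negPn/negP=> yM.
  have yXY : y \in X :|: Y by rewrite in_setU yY orbT.
  have [] := sep _ _ uX yY.
  by rewrite (ends_free_eq XY uXY yXY uM yM) eqxx.
have cardM := card_matched XY; have cardXYW := card_matched_split XY.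
rewrite (setIidPl YM) in cardXYW.
have := card_end_matched YX; rewrite (setIidPl YM) => leY.
set NM := neighbors H X :&: M.
have NM2 : #|NM| <= 2.
  by rewrite -(card_end_neighbors XY) subset_leq_card ?subsetIl.
have NMW : NM \subset W X Y.
  by apply/subsetP=> z /setIP[zN zM]; rewrite in_rest // (end_neighbor_notin XY).
have le_S := end_free_matched XY uXY uM.
have Su_sub z : z \in S u -> (z \in X :&: M) || (z \in NM).
  rewrite inE => /andP[zM euz]; rewrite !in_setI zM !andbT -in_setU.
  by apply: end_in_union uX _; rewrite free_rem.
have leSu : #|S u| <= #|X :&: M| + #|NM|.
  rewrite (leq_trans _ (leq_card_setU _ _)) // subset_leq_card //.
  by apply/subsetP=> z /Su_sub; rewrite in_setU.
have NMW_le := subset_leq_card NMW.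
have Yd : #|Y| + 2 = d by move: leSu NMW_le le_S cardXYW cardM leY; card_lia.
(* Otherwise both ends have the same two neighbors, forming [W X Y]. A free leaf other than [u] has
   more than two covered neighbors, hence one in an end, and would itself be a neighbor of that
   end. *)
have [p pN pM] : exists2 p, p \in neighbors H Y & p \notin M.
  apply/subsetPn/negP=> NYM.
  have NYW : neighbors H Y \subset W X Y.
    apply/subsetP=> z zN; rewrite in_rest ?(subsetP NYM) //.
    by rewrite setUC (end_neighbor_notin YX).
  have W2 : #|W X Y| = 2.
    move: (subset_leq_card NYW) (card_end_matched XY); rewrite (card_end_neighbors YX).
    by move: Yd cardM cardXYW; card_lia.
  have eqW (A : {set T}) : A \subset W X Y -> 1 < #|A| -> A = W X Y.
    by move=> AW A2; apply/eqP; rewrite eqEcard AW W2.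
  have NXW : neighbors H X = W X Y.
    have NMe : NM = W X Y.
      by apply: eqW => //; move: leSu le_S W2 Yd cardM cardXYW; card_lia.
    apply/esym/eqP; rewrite eqEcard W2 (card_end_neighbors XY) andbT -NMe.
    exact: subsetIl.
  have NYe : neighbors H Y = W X Y by apply: eqW => //; rewrite (card_end_neighbors YX).
  have [v [vM vu leSv]] : exists v, [/\ v \notin M, v != u & d <= #|S v|.+1].
    have [l1 [l2 [l1M l2M l12 n1 n2]]] := free_leaves.
    by have [l1u|l1u] := eqVneq l1 u; [exists l2; rewrite -l1u eq_sym | exists l1].
  have vXY : v \notin X :|: Y.
    by apply: contra vu => vXY; apply/eqP/(ends_free_eq XY).
  have [z] : exists z, z \in S v :\: W X Y.
    apply/card_gt0P; rewrite cardsD.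
    have := subset_leq_card (subsetIr (S v) (W X Y)).
    by move: leSv W2 d5; card_lia.
  rewrite in_setD => /andP[zW]; rewrite inE => /andP[zM evz].
  rewrite in_rest // negbK in zW.
  have := free_neighbor XY vXY vM zW evz.
  by rewrite NXW NYe setUid in_setD (negbTE vM) andbF.
have pu : p != u.
  by apply: contraTneq uXY => <-; rewrite setUC (end_neighbor_notin YX).
set Z := [set y in Y | m y \in X].
(* By tightness, no partner of a vertex of [Y] is in [Y], so partners outside [X] are in [W X Y]. *)
have leZ : #|Y| <= #|Z| + #|W X Y|.
  rewrite -(cardsID Z Y) leq_add //; first exact: subset_leq_card (subsetIr _ _).
  rewrite -(card_imset (mem (Y :\: Z)) (can_inj mK)) subset_leq_card //.
  apply/subsetP=> _ /imsetP[y /setDP[yY yZ] ->].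
  have [_ myY] := tight_end YX Yd yY.
  rewrite in_rest ?mM_in ?(subsetP YM) // in_setU negb_or.
  move: yZ myY; rewrite inE yY in_setU negb_or => -> /andP[-> _].
  by [].
have leSuZ : #|S u| + #|Z| <= #|X :&: M| + #|NM|.
  rewrite -(card_imset (mem Z) (can_inj mK)).
  (* As [p] is adjacent to all of [Y], an edge from [u] to the partner of a vertex of [Z] would
     allow a flip. *)
  have dis : [disjoint S u & [set m y | y in Z]].
    rewrite disjoint_sym disjoint_subset; apply/subsetP=> _ /imsetP[y yZ ->].
    move: yZ; rewrite !inE => /andP[yY myX]; apply/negP=> /andP[_ eumy].
    have [adj _] := tight_end YX Yd yY.
    have py : p != y by apply: contraNneq pM => ->; apply: (subsetP YM).
    have Hpy : H p y by rewrite symH adj // in_setU pN orbT.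
    rewrite free_rem // in Hpy.
    by apply: (end_flip XY uM pM _ myX _ eumy); rewrite ?mK // eq_sym.
  rewrite -cardsUI (_ : (_ :&: [set _ | _ in _]) = set0) ?cards0 ?addn0; last first.
    by apply/eqP; rewrite setI_eq0.
  apply: leq_trans (leq_card_setU _ _); apply/subset_leq_card/subsetP=> z.
  rewrite in_setU => /orP[/Su_sub|/imsetP[y yZ ->]]; first by rewrite in_setU.
  by move: yZ; rewrite inE => /andP[yY myX]; rewrite in_setU in_setI myX mM_in (subsetP YM).
(* The count forces [Z] empty and [#|W X Y|] at most two, while [Y] has [d - 2], at least three,
   vertices. *)
by move: leSuZ leZ le_S Yd cardM cardXYW NMW_le NM2 d5; card_lia.
Qed.

Lemma end_matched X Y : remote_ends X Y -> X \subset M.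
Proof. by move=> XY; apply/subsetP=> x; apply: (no_free_in_end XY). Qed.

Lemma card_ends X Y : remote_ends X Y ->
  [/\ #|X| + #|Y| + #|W X Y| + 2 = 2 * d, d <= #|X| + 2 & d <= #|Y| + 2].
Proof.
move=> XY; have YX := remote_endsC XY.
move: (card_matched_split XY) (card_matched XY) (card_end_matched XY) (card_end_matched YX).
rewrite (setIidPl (end_matched XY)) (setIidPl (end_matched YX)) => <- <- lX lY.
by split.
Qed.

(** * Excluding ends of size [d - 2] *)

Let R X := M :\: (X :|: [set m x | x in X]).

(** Both sets have at most two vertices. Four in all would make [Y] tight and put [R X], which is
    closed under [m], inside [Y]; but partners in a tight end do not stay in it. *)
Lemma card_rest_le3 X Y : remote_ends X Y -> #|X| + 2 = d -> #|W X Y :|: R X| <= 3.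
Proof.
move=> XY Xd; have [sum _ leY] := card_ends XY.
have XM := subsetP (end_matched XY).
have mX x : x \in X -> m x \notin X.
  by move=> xX; have [_] := tight_end XY Xd xX; rewrite in_setU negb_or => /andP[].
have R2 : #|R X| = 2.
  have := cardsID (X :|: [set m x | x in X]) M; rewrite -/(R X).
  rewrite (_ : M :&: _ = X :|: [set m x | x in X]); last first.
    apply/setIidPr/subsetP=> z; rewrite in_setU => /orP[/XM //|/imsetP[x /XM xM ->]].
    by rewrite mM_in.
  rewrite cardsU (card_imset _ (can_inj mK)).
  have -> : X :&: [set m x | x in X] = set0.
    apply/setP=> z; rewrite in_set0; apply/negP=> /setIP[zX /imsetP[x xX zE]].
    by have := mX x xX; rewrite -zE zX.
  by rewrite cards0; move: (card_matched XY) Xd; card_lia.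
rewrite leqNgt; apply/negP=> gt3; have [W2 I0 Yd] :
    [/\ #|W X Y| = 2, #|W X Y :&: R X| = 0 & #|Y| + 2 = d].
  by split; move: gt3; rewrite cardsU R2; move: sum leY Xd; card_lia.
have [a aR] : exists a, a \in R X by apply/card_gt0P; rewrite R2.
have RY z : z \in R X -> z \in Y.
  move=> zR; have zW : z \notin W X Y.
    by apply/negP=> zW; have := cards0_eq I0 => /setP/(_ z); rewrite !in_setI zW zR in_set0.
  move: zR; rewrite in_setD in_setU => /andP[/norP[zX _] zM].
  by move: zW; rewrite in_rest // negbK in_setU (negbTE zX).
have [_] := tight_end (remote_endsC XY) Yd (RY a aR); rewrite in_setU negb_or.
case/andP=> /negP[]; apply: RY; move: aR; rewrite !in_setD !in_setU mM_in.
case/andP=> /norP[aX amX] ->; rewrite andbT; apply/norP; split.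
  by apply: contra amX => maX; apply/imsetP; exists (m a).
by apply: contra aX => /imsetP[x xX /(can_inj mK)->].
Qed.

(* As [p] is adjacent to all of [X], flipping shows that no other free vertex
   sees a vertex of [Y] that is matched into [X]. *)
Lemma tight_end_leaf X Y p l : remote_ends X Y -> #|X| + 2 = d ->
  p \in neighbors H X -> p \notin M -> l \notin M -> d <= #|S l|.+1 ->
  l \in neighbors H X.
Proof.
move=> XY Xd pN pM lM leS; apply/negPn/negP=> lN.
have sub : S l \subset W X Y :|: R X.
  apply/subsetP=> z; rewrite inE => /andP[zM elz]; rewrite in_setU in_rest //.
  have zX : z \notin X.
    apply: contra lN => zX; have lX : l \notin X.
      by apply: contra lM; exact: (no_free_in_end XY).
    by apply: neighborsI zX lX _; rewrite symH free_rem.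
  rewrite in_setU (negbTE zX) /=; have [zY|//] := boolP (z \in Y).
  rewrite in_setD in_setU (negbTE zX) zM andbT /=; apply/imsetP=> -[x xX zE].
  have [adj _] := tight_end XY Xd xX.
  have px : p != x by apply: contraNneq pM => ->; apply: (subsetP (end_matched XY)).
  have Hpx : H p x by rewrite symH adj // in_setU pN orbT.
  have pl : p != l by apply: contraNneq lN => <-.
  by rewrite free_rem // in Hpx; apply: (end_flip XY pM lM pl xX _ Hpx); rewrite -zE.
by move: (subset_leq_card sub) (card_rest_le3 XY Xd) leS d5; card_lia.
Qed.

(** If both neighbors of [X] are free, they are adjacent to all of [X]. For an [x] in [X] matched
    into [Y], the exchanges leave [m x] at most three neighbors in [H], but it has at least four. *)
Lemma tight_end_neighbors X Y : remote_ends X Y -> #|X| + 2 = d ->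
  exists2 p, p \in neighbors H X & p \in M.
Proof.
move=> XY Xd; apply/exists_inP; apply: contraT => /exists_inPn NU.
have YX := remote_endsC XY; have XM := subsetP (end_matched XY).
have [sum _ leY] := card_ends XY; have [_ _ sep] := XY.
have adj x := (tight_end XY Xd (x := x)).
have N2 := card_end_neighbors XY.
have [x xX myY] : exists2 x, x \in X & m x \in Y.
  apply/exists_inP; apply: contraT => /exists_inPn noY.
  have : [set m x | x in X] \subset W X Y.
    apply/subsetP=> _ /imsetP[x xX ->]; rewrite in_rest ?mM_in ?XM // in_setU negb_or noY //.
    by have [_] := adj x xX; rewrite in_setU negb_or andbT => /andP[].
  by move/subset_leq_card; rewrite (card_imset _ (can_inj mK)); move: sum leY Xd d5; card_lia.
have Hp p x1 : p \in neighbors H X -> x1 \in X -> e p x1.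
  move=> pN x1X; have pM := NU p pN; rewrite -free_rem // symH.
  have [-> //] := adj x1 x1X; first by rewrite in_setU pN orbT.
  by apply: contraNneq pM => ->; apply: XM.
have noU v : v \notin M -> ~~ e v (m x).
  move=> vM; apply/negP=> evy; have [p] : exists p, p \in neighbors H X :\ v.
    apply/card_gt0P; move: (cardsD1 v (neighbors H X)); rewrite N2.
    by case: (v \in _); card_lia.
  rewrite in_setD1 => /andP[pv pN].
  exact: (end_flip XY (NU p pN) vM pv xX myY (Hp p x pN xX) evy).
have indep x2 : x2 \in X -> m x2 \in Y -> ~~ H (m x) (m x2).
  move=> x2X my2; apply/negP=> Hyy.
  have x2x : x2 != x by apply: contraTneq Hyy => ->; rewrite irrH.
  have [p [q [pN qN pq]]] : exists p q, [/\ p \in neighbors H X, q \in neighbors H X & p != q].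
    by have /card_gt1P : 1 < #|neighbors H X| by rewrite N2.
  have HH r z : r \in neighbors H X -> z \in X -> H r z.
    by move=> rN zX; rewrite free_rem ?NU ?Hp.
  have Hxx2 : H x x2 by have [-> //] := adj x xX; rewrite in_setU x2X.
  have Hx2x : H x2 x by rewrite symH.
  (* The common neighbors required are [x2] for [p] and [x], and [x] for [q] and [x2]. *)
  by apply: (end_augment5 XY (NU p pN) (NU q qN) pq xX x2X myY my2 Hxx2 Hyy x2x
    (HH p x2 pN x2X) Hx2x (HH q x qN xX) Hxx2); apply: Hp.
have sub : forall z, H (m x) z -> z \in W X Y :|: R X.
  move=> z Hyz; have zM : z \in M.
    apply/negPn/negP=> zM; have := noU z zM; rewrite sym_e.
    by case/andP: Hyz => ->.
  rewrite in_setU in_rest //.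
  have zX : z \notin X.
    by apply/negP=> zX; have [_] := sep _ _ zX myY; rewrite symH Hyz.
  rewrite in_setU (negbTE zX) /=; have [zY|//] := boolP (z \in Y).
  rewrite in_setD in_setU (negbTE zX) zM andbT /=; apply/imsetP=> -[x2 x2X zE].
  by have := indep x2 x2X; rewrite -zE zY Hyz => /(_ isT).
by move: (degree_sub sub) (degree_remainder_gt3 (m x)) (card_rest_le3 XY Xd); card_lia.
Qed.

(** A free neighbor of a tight end would make both leaves its neighbors, leaving no covered one. So
    the neighbors of [X] fill [W X Y] and [Y] is tight too; a free leaf must then be a neighbor of
    [Y]. *)
Lemma end_not_tight X Y : remote_ends X Y -> #|X| + 2 <> d.
Proof.
have leaf_all X1 Y1 : remote_ends X1 Y1 -> #|X1| + 2 = d ->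
    ~ exists2 p, p \in neighbors H X1 & p \notin M.
  move=> XY Xd [p pN pM]; have [l1 [l2 [l1M l2M l12 n1 n2]]] := free_leaves.
  have l1N := tight_end_leaf XY Xd pN pM l1M n1.
  have l2N := tight_end_leaf XY Xd pN pM l2M n2.
  have NE : [set l1; l2] = neighbors H X1.
    apply/eqP; rewrite eqEcard cards2 l12 (card_end_neighbors XY) andbT.
    by apply/subsetP=> z /set2P[]->.
  have [q] := tight_end_neighbors XY Xd.
  by rewrite -NE => /set2P[]->; [rewrite (negbTE l1M) | rewrite (negbTE l2M)].
move=> XY Xd; have YX := remote_endsC XY; have [sum _ leY] := card_ends XY.
have NXM p : p \in neighbors H X -> p \in M.
  by move=> pN; apply/negPn/negP=> pM; apply: (leaf_all X Y XY Xd); exists p.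
have NXW : neighbors H X \subset W X Y.
  by apply/subsetP=> p pN; rewrite in_rest ?NXM // (end_neighbor_notin XY).
have W2 := subset_leq_card NXW; rewrite (card_end_neighbors XY) in W2.
have Yd : #|Y| + 2 = d by move: sum leY W2 Xd; card_lia.
apply: (leaf_all Y X YX Yd); have [l [_ [lM _ _ leS _]]] := free_leaves; exists l => //.
have lXY : l \notin X :|: Y.
  by apply: contra lM; rewrite in_setU => /orP[]; apply: no_free_in_end; eassumption.
have [z] : exists z, z \in S l :\: W X Y.
  apply/card_gt0P; rewrite cardsD; have := subset_leq_card (subsetIr (S l) (W X Y)).
  by move: leS sum Xd Yd d5; card_lia.
rewrite in_setD => /andP[zW]; rewrite inE => /andP[zM elz]; rewrite in_rest // negbK in zW.
have := free_neighbor XY lXY lM zW elz; rewrite in_setU => /orP[/NXM|//].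
by rewrite (negbTE lM).
Qed.

(** * Ends of size [d - 1] that contain all covered vertices *)

Lemma card_ends_eq X Y : remote_ends X Y ->
  [/\ #|X| + 1 = d, #|Y| + 1 = d & M \subset X :|: Y].
Proof.
move=> XY; have YX := remote_endsC XY; have [sum lX lY] := card_ends XY.
have nX := end_not_tight XY; have nY := end_not_tight YX.
have W0 : #|W X Y| = 0 by move: sum lX lY nX nY; card_lia.
split; [by move: sum lX lY nX nY; card_lia | by move: sum lX lY nX nY; card_lia |].
by rewrite -setD_eq0 -cards_eq0; apply/eqP.
Qed.

Lemma end_neighbors_free X Y p : remote_ends X Y -> p \in neighbors H X -> p \notin M.
Proof.
move=> XY pN; have [_ _ MXY] := card_ends_eq XY.
by apply: contra (end_neighbor_notin XY pN); apply: (subsetP MXY).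
Qed.

(** A pair inside [X] would, by its degrees in [e], be completely joined to both neighbors of [X],
    against [end_triangle]. *)
Lemma end_matched_across X Y x : remote_ends X Y -> x \in X -> m x \in Y.
Proof.
move=> XY xX; have [Xd _ MXY] := card_ends_eq XY; have XM := subsetP (end_matched XY).
have : m x \in X :|: Y by rewrite (subsetP MXY) // mM_in XM.
rewrite in_setU => /orP[mxX|//]; exfalso.
have full z : z \in X -> m z \in X -> {in neighbors H X, forall p, e p z}.
  move=> zX mzX p pN.
  have sub : [set y | e z y] \subset (X :|: neighbors H X) :\ z.
    apply/subsetP=> y; rewrite inE in_setD1 => ezy.
    have -> /= : y != z by apply: contraTneq ezy => ->; rewrite irr_e.
    have [<-|mzy] := eqVneq (m z) y; first by rewrite in_setU mzX.
    by apply: end_in_union zX _; rewrite /H /remainder /= ezy.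
  have eqN : [set y | e z y] = (X :|: neighbors H X) :\ z.
    apply/eqP; rewrite eqEcard sub -degreeE /=.
    move: (cardsD1 z (X :|: neighbors H X)) (leq_card_setU X (neighbors H X)).1.
    rewrite in_setU zX (card_end_neighbors XY) /=.
    by move: (deg_e z) Xd; card_lia.
  have pz : p != z by apply: contraNneq (end_neighbors_free XY pN) => ->; apply: XM.
  have : p \in [set y | e z y] by rewrite eqN in_setD1 pz in_setU pN orbT.
  by rewrite inE sym_e.
have /card_gt1P[p [q [pN qN pq]]] : 1 < #|neighbors H X| by rewrite (card_end_neighbors XY).
have mmx : m (m x) \in X by rewrite mK.
by apply: (end_triangle XY (end_neighbors_free XY pN) (end_neighbors_free XY qN) pq
  (XM x xX) xX mxX); [apply: full | apply: (full (m x)) | apply: (full (m x))].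
Qed.

(** The degree of [m x] gives it a neighbor [v] outside [Y]; whichever of [p] and [q] differs from
    [v] allows a flip. *)
Lemma end_one_neighbor X Y x p q : remote_ends X Y -> x \in X ->
  p \in neighbors H X -> q \in neighbors H X -> p != q -> H x p -> H x q -> False.
Proof.
move=> XY xX pN qN pq Hxp Hxq; have YX := remote_endsC XY.
have yY := end_matched_across XY xX; have [_ Yd _] := card_ends_eq XY.
have [v vN Hyv] : exists2 v, v \in neighbors H Y & H (m x) v.
  apply/exists_inP; apply: contraT => /exists_inPn noN.
  have : forall z, H (m x) z -> z \in Y :\ m x.
    move=> z Hyz; rewrite in_setD1.
    have -> /= : z != m x by apply: contraTneq Hyz => ->; rewrite irrH.
    have := end_in_union yY Hyz; rewrite in_setU => /orP[//|zN].
    by move: (noN z zN); rewrite Hyz.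
  move/degree_sub; move: (cardsD1 (m x) Y) (degree_remainder (m x)).
  by rewrite yY; move: Yd; card_lia.
have vM := end_neighbors_free YX vN.
have evy : e v (m x) by rewrite -free_rem // symH.
have flip r : r \in neighbors H X -> H x r -> r != v -> False.
  move=> rN Hxr rv; have rM := end_neighbors_free XY rN.
  by apply: (end_flip XY rM vM rv xX yY _ evy); rewrite -free_rem // symH.
have [pv|/(flip p pN Hxp) //] := eqVneq p v.
by apply: (flip q qN Hxq); rewrite -pv eq_sym.
Qed.

(** Each [x] already misses one of the two neighbors of [X]; missing also a vertex of [X] would
    bring its degree below [d - 1]. *)
Lemma end_clique X Y : remote_ends X Y -> {in X &, forall x z, x != z -> H x z}.
Proof.
move=> XY x z xX zX xz; have [Xd _ _] := card_ends_eq XY.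
have /card_gt1P[p [q [pN qN pq]]] : 1 < #|neighbors H X| by rewrite (card_end_neighbors XY).
apply: contraT => nHxz.
have [r rN nHxr] : exists2 r, r \in neighbors H X & ~~ H x r.
  have [Hxp|] := boolP (H x p); last by exists p.
  have [Hxq|] := boolP (H x q); last by exists q.
  by case: (end_one_neighbor XY xX pN qN pq Hxp Hxq).
have : forall y, H x y -> y \in (X :\ x :\ z) :|: (neighbors H X :\ r).
  move=> y Hxy; have := end_in_union xX Hxy; rewrite !in_setU !in_setD1.
  have -> : y != x by apply: contraTneq Hxy => ->; rewrite irrH.
  have -> : y != z by apply: contraTneq Hxy => ->.
  by have -> : y != r by apply: contraTneq Hxy => ->.
move/degree_sub/leq_trans/(_ (leq_card_setU _ _)).
move: (cardsD1 x X) (cardsD1 z (X :\ x)) (cardsD1 r (neighbors H X)) (degree_remainder x).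
rewrite xX in_setD1 eq_sym xz zX rN (card_end_neighbors XY) /=.
by move: Xd; card_lia.
Qed.

(** The neighbors [p] and [q] of [X] have two neighbors each in [X], all four distinct. As both ends
    are cliques matched across, these admit the exchange of length five. *)
Lemma no_small_maximum_matching : False.
Proof.
have [X [Y XY]] := exists_remote_ends; have YX := remote_endsC XY.
have [endX _ _] := XY.
have /card_gt1P[p [q [pN qN pq]]] : 1 < #|neighbors H X| by rewrite (card_end_neighbors XY).
have [x1 [c [x1X cX x1c Hpx1 Hpc]]] := end_fragment_neighbor2 symH irrH cH deg3 endX pN.
have [x2 [c' [x2X c'X x2c' Hqx2 Hqc']]] := end_fragment_neighbor2 symH irrH cH deg3 endX qN.
have ne a b : a \in X -> H p a -> H q b -> a != b.
  move=> aX Hpa Hqb; apply/eqP=> ab; rewrite -ab in Hqb.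
  by apply: (end_one_neighbor XY aX pN qN pq); rewrite symH.
have clX := end_clique XY; have x12 := ne _ _ x1X Hpx1 Hqx2.
have y1Y := end_matched_across XY x1X; have y2Y := end_matched_across XY x2X.
have pM := end_neighbors_free XY pN; have qM := end_neighbors_free XY qN.
apply: (end_augment5 XY pM qM pq x1X x2X y1Y y2Y _ _ (ne _ _ cX Hpc Hqc') Hpc _ Hqc');
  rewrite -?free_rem //; first exact: clX.
- by apply: (end_clique YX); rewrite // (can_eq mK).
- by apply: clX; rewrite // eq_sym.
- by apply: clX; rewrite // eq_sym.
Qed.

End Maximum.

(** * From involutions to matchings *)

Section TwoConnected.

Variables (T : finType) (K : rel T).
Implicit Types (w x y : T).

Lemma two_connected_biconnected : two_connected K -> biconnected K.
Proof.
case=> T3 connK noCut; apply: biconnectedP => // w A [wA A0 B0 nK].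
case/set0Pn: A0 => x xA; case/set0Pn: B0 => y; rewrite !inE negb_or => /andP[yw yA].
case: (noCut w); exists x, y; split; rewrite ?connK //.
  by apply: contraNneq wA => <-.
apply: contra yA => /connectP[p pth ->]; elim: p x xA pth => //= z p IH x xA.
case/andP=> /and3P[Kxz xw zw]; apply: IH.
by apply: contraTT Kxz => zA; apply: nK.
Qed.

Lemma biconnected_connect w x y : biconnected K -> x != w -> y != w ->
  connect (del_vertex K w) x y.
Proof.
move=> cK xw yw; set A := [set z | connect (del_vertex K w) x z].
have Aw z : z \in A -> z != w.
  rewrite inE => /connectP[p]; case/lastP: p => [_ -> //|p t].
  by rewrite rcons_path last_rcons => /andP[_ /and3P[_ _ tw]] ->.
have [|yA] := boolP (y \in A); first by rewrite inE.
have wA : w \notin A by apply/negP=> /Aw; rewrite eqxx.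
have xA : x \in A by rewrite inE connect0.
have [a [b [aA bA bw Kab]]] := biconnected_edge cK wA xA yA yw.
case/negP: bA; rewrite inE; move: (aA); rewrite inE => /connect_trans; apply.
by apply: connect1; rewrite /del_vertex /= Kab bw Aw.
Qed.

Lemma biconnected_two_connected : biconnected K -> two_connected K.
Proof.
move=> cK; have T3 := biconnected_gt2 cK; split=> // [x y|w [x [y [xw yw _]]]]; last first.
  by rewrite biconnected_connect.
(* Removal of a third vertex leaves [x] and [y] joined. *)
have [w] : exists w, w \in ~: [set x; y].
  by apply/card_gt0P; move: (cardsC [set x; y]) T3; rewrite cards2; case: eqP; card_lia.
rewrite !inE negb_or => /andP[wx wy].
have := biconnected_connect (w := w) (x := x) (y := y) cK.
rewrite eq_sym wx eq_sym wy => /(_ isT isT).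
by apply: connect_sub => a b /and3P[Kab _ _]; apply: connect1.
Qed.

End TwoConnected.

Lemma min_degree_le (T : finType) (e : rel T) x : min_degree e <= degree e x.
Proof.
rewrite /min_degree; have : x \in index_enum T by rewrite mem_index_enum.
elim: (index_enum T) => // y r IH; rewrite inE big_cons geq_min.
by case/orP=> [/eqP->|/IH->]; rewrite ?leqnn ?orbT.
Qed.

Section Pairs.

Variables (T : finType) (e : rel T) (m : T -> T).
Hypotheses (irr_e : irreflexive e) (mM : matching_fun e m).

Definition pairs : {set {set T}} := [set [set x; m x] | x in matched m].

Let mK : involutive m. Proof. by case: mM. Qed.

Lemma pairs_partition : partition pairs (matched m).
Proof.
apply/and3P; split.
- apply/eqP/setP=> x; apply/bigcupP/idP => [[_ /imsetP[y yM ->]]|xM].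
    by move: yM; rewrite !inE => my /orP[] /eqP->; rewrite // (can_eq mK).
  by exists [set x; m x]; rewrite ?set21 //; apply: imset_f.
- apply/trivIsetP=> _ _ /imsetP[x _ ->] /imsetP[y _ ->] xy.
  rewrite -setI_eq0; apply: contraNT xy => /set0Pn[z]; rewrite !inE.
  by case/andP=> /orP[] /eqP-> /orP[/eqP zE|/eqP zE];
    rewrite ?zE ?mK // ?(can_inj mK zE) // -?zE ?mK 1?setUC //.
- by apply/imsetP=> -[x _ /setP/(_ x)]; rewrite !inE eqxx.
Qed.

Lemma card_matched_pairs : #|matched m| = #|pairs| * 2.
Proof.
apply: card_uniform_partition pairs_partition => _ /imsetP[x xM ->].
by rewrite cards2 eq_sym; move: xM; rewrite inE => ->.
Qed.

Lemma pairs_matching : matching e pairs.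
Proof.
split; last by have /and3P[] := pairs_partition.
apply/subsetP=> _ /imsetP[x xM ->]; apply/imsetP; exists (x, m x) => //.
by rewrite !inE /= in xM *; case: mM => _; apply.
Qed.

Lemma pairs_removable : biconnected (remainder e m) -> removable e pairs.
Proof.
move=> cR; apply: biconnected_two_connected; apply: sub_biconnected cR => x y.
rewrite /remainder /del_edges /= => /andP[exy mxy]; rewrite exy /=.
apply: contra mxy => /imsetP[z _ /setP E]; have := E x; have := E y.
rewrite !inE !eqxx orbT /= => /esym yE /esym xE.
have xy : x != y by apply: contraTneq exy => ->; rewrite irr_e.
by case/orP: xE xy => /eqP->; case/orP: yE => /eqP->; rewrite ?mK ?eqxx.
Qed.

End Pairs.

Theorem theorem1p1 (d : nat) (T : finType) (e : rel T) :
  5 <= d ->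
  simple_graph e ->
  two_connected e ->
  d <= min_degree e ->
  2 * d <= #|T| ->
  exists M : {set {set T}}, [/\ matching e M, #|M| = d & removable e M].
Proof.
move=> d5 [sym_e irr_e] /two_connected_biconnected ce deg T2d.
have deg_e x : d <= degree e x := leq_trans deg (min_degree_le e x).
(* Finite functions allow a maximum to be chosen; the cap [2 * d] makes it either a [d]-matching or
   too small. *)
pose good (m : {ffun T -> T}) := [&& [forall x, m (m x) == x],
  [forall x, (m x != x) ==> e x (m x)], biconnected (remainder e m) & #|matched m| <= 2 * d].
have goodP m : good m -> [/\ matching_fun e m, biconnected (remainder e m)
    & #|matched m| <= 2 * d].
  case/and4P=> /forallP mK /forallP me cm dm; split=> //; split=> x; first exact/eqP.
  exact/implyP.
have good_id : good [ffun x => x].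
  apply/and4P; split.
  - by apply/forallP=> x; rewrite !ffunE.
  - by apply/forallP=> x; rewrite ffunE eqxx.
  - apply: sub_biconnected ce => x y exy; rewrite /remainder /= ffunE exy /=.
    by apply: contraTneq exy => ->; rewrite irr_e.
  - rewrite (_ : matched _ = set0) ?cards0 //.
    by apply/setP=> x; rewrite !inE ffunE eqxx.
case: (arg_maxnP (fun m : {ffun T -> T} => #|matched m|) good_id) => m /goodP[mM cm dm] m_max.
have [md|md] := eqVneq #|matched m| (2 * d).
  exists (pairs m); split; [exact: pairs_matching | | exact: pairs_removable].
  by apply/eqP; rewrite -(eqn_pmul2r (isT : 0 < 2)) -(card_matched_pairs mM) md mulnC.
case: (@no_small_maximum_matching d T e m) => //.
- by rewrite (card_matched_pairs mM) muln2 odd_double.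
- by rewrite ltn_neqAle md.
move=> m' [m'K m'e] card'; apply/negP=> cm'.
have eqm : matched (finfun m') = matched m' by apply/setP=> x; rewrite !inE ffunE.
suff /m_max : good (finfun m') by rewrite eqm card' /= ltnNge leqnSn.
apply/and4P; split.
- by apply/forallP=> x; rewrite !ffunE m'K.
- by apply/forallP=> x; rewrite ffunE; apply/implyP/m'e.
- by apply: sub_biconnected cm' => x y; rewrite /remainder /= ffunE.
(* By parity, a size below [2 * d] leaves room for two more covered vertices under the cap. *)
rewrite eqm card'; move: md dm; rewrite (card_matched_pairs mM).
by card_lia.
Qed.
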